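(* Let $a,b,c\in\mathbb{R}$ be such that $a>-1$, $b>-1$ and $c>\max\{0,a-b\}$ and, for each $n\ge 1$, let $Q_n^{[d]}(x;a,b,c)$, $d\in\{0,1\}$, be the type I function for the index of length $n$ on the step line with respect to $\overline{\mathcal{W}}^{[d]}(x;a,b,c)$. Then $$Q_n^{[d]}(x;a,b,c)=\frac{(-1)^{n-1}}{(n-1)!}\,\frac{d^{\,n-1}}{dx^{\,n-1}}\left(\mathcal{W}\left(x;\,a+n-1,\,b+n-1,\,c+\left\lfloor\frac{n+d}{2}\right\rfloor\right)\right).$$
   Context: For $\alpha>0$, $\beta\in\mathbb{R}$, $x>0$, the Tricomi function is $\mathbf{U}(\alpha,\beta;x)=\frac{1}{\Gamma(\alpha)}\int_0^\infty t^{\alpha-1}(t+1)^{\beta-\alpha-1}e^{-tx}\,dt$. For $a>-1$, $b>-1$, $c>\max\{0,a-b\}$ and $x>0$ define $$\mathcal{W}(x;a,b,c)=\frac{\Gamma(c+b+1)}{\Gamma(a+1)\Gamma(b+1)}\,e^{-x}x^a\,\mathbf{U}(c,a-b+1;x),\qquad \overline{\mathcal{W}}^{[d]}(x;a,b,c)=\begin{bmatrix}\mathcal{W}(x;a,b,c+d)\\ \mathcal{W}(x;a,b,c+1-d)\end{bmatrix},\quad d\in\{0,1\}.$$ The type I function for the index of length $n$ on the step-line with respect to a vector of weights $(w_0,w_1)$ on $(0,\infty)$ is $Q_n=A_nw_0+B_nw_1$, where $A_n,B_n$ are polynomials with $\deg A_n\le\lceil n/2\rceil-1$, $\deg B_n\le\lfloor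 n/2\rfloor-1$ (a polynomial of degree $\le -1$ is zero) such that $\int_0^\infty x^kQ_n(x)\,dx=0$ for $0\le k\le n-2$ and $=1$ for $k=n-1$. For the weights considered here it exists and is unique. *)

(* Defs.v *)
From HB Require Import structures.
From mathcomp Require Import all_boot all_order all_algebra.
From mathcomp Require Import all_classical all_reals all_analysis.

Set Implicit Arguments.
Unset Strict Implicit.
Unset Printing Implicit Defensive.
Import Order.TTheory GRing.Theory Num.Theory.
Import numFieldNormedType.Exports.

Local Open Scope classical_set_scope.
Local Open Scope ring_scope.

(* [\int[mu]_(x in D) f x] in [ring_scope] is [Rintegral], which returns 0 when
   the Lebesgue integral is infinite. Below, [Gamma] is only used at positive
   arguments, and [tricomi] only at first argument > 0 and x > 0, where the
   integrals converge. *)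

Definition Gamma (R : realType) (s : R) : R :=
  \int[lebesgue_measure]_(t in `]0%R, +oo[) (t `^ (s - 1) * expR (- t)).

Definition tricomi (R : realType) (alpha beta x : R) : R :=
  (Gamma alpha)^-1 *
  \int[lebesgue_measure]_(t in `]0%R, +oo[)
    (t `^ (alpha - 1) * (t + 1) `^ (beta - alpha - 1) * expR (- (t * x))).

Definition weightW (R : realType) (a b c x : R) : R :=
  Gamma (c + b + 1) / (Gamma (a + 1) * Gamma (b + 1)) *
  expR (- x) * x `^ a * tricomi c (a - b + 1) x.

Definition weightWbar (R : realType) (d : nat) (a b c : R) :
    (R -> R) * (R -> R) :=
  (weightW a b (c + d%:R), weightW a b (c + 1 - d%:R)).

(* [Q] coincides on (0, +oo) with a type I function for the index of length [n]
   (intended for n >= 1) on the step-line with respect to the weights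
   [w = (w_0, w_1)] on (0, +oo).
   As [size p] is 1 + deg p (and 0 for p = 0), the degree bounds
   ceil(n/2) - 1 and floor(n/2) - 1 become bounds by [uphalf n] and [n./2] on
   the sizes.  The moments are extended-real integrals, so that having a finite
   value is part of the condition. *)
Definition is_type_I_function (R : realType) (n : nat)
    (w : (R -> R) * (R -> R)) (Q : R -> R) : Prop :=
  exists A B : {poly R},
    [/\ (size A <= uphalf n)%N,
        (size B <= n./2)%N,
        (forall x : R, 0 < x -> Q x = A.[x] * w.1 x + B.[x] * w.2 x),
        (forall k : nat, (k.+1 < n)%N ->
          (\int[lebesgue_measure]_(x in `]0%R, +oo[) (x ^+ k * Q x)%:E = 0)%E)
      & (\int[lebesgue_measure]_(x in `]0%R, +oo[) (x ^+ n.-1 * Q x)%:E = 1)%E].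

(* Main.v *)
Require Import Defs.
From HB Require Import structures.
From mathcomp Require Import all_boot all_order all_algebra.
From mathcomp Require Import all_classical all_reals all_analysis.
From mathcomp Require Import measurable_realfun zify ring lra.
Import Order.TTheory GRing.Theory Num.Theory.
Import numFieldNormedType.Exports.
Local Open Scope classical_set_scope.
Local Open Scope ring_scope.

(** Put V_c(x) = x^a e^(-x) U(c, a-b+1; x), so that W(.; a, b, c) is the positive
multiple of V_c of total mass one.  The two weights are multiples of V_c and
V_(c+1), and a candidate for the type I function is P V_c + Q V_(c+1) with
size P <= p and size Q <= r, where p + r = n and r = floor((n+d)/2): the
parameter d only says which of the two weights comes first.

Everything is read off the moments of V_c,
    m_c(k) = Gamma(a+k+1) Gamma(b+k+1) / Gamma(c+b+k+1),
which Tonelli reduces to the beta integral ([beta_integral],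
[integral_monomial_weight]).

The derivative has the required form.  Since U depends on a and b only through
a - b, the function x V_c is V_c for the parameters a+1, b+1.  Integration by
parts in the integral defining U gives first order relations that express
(x V_c)' and (x V_(c+1))' by V_c and V_(c+1) with polynomial coefficients.  So
differentiation maps a combination for a+1, b+1 to one for a, b, at the cost of
one more coefficient ([is_derive_pair]), and it maps the moments f(k) to
-k f(k-1) ([pair_moment_derive]).  After n-1 derivatives of
V(a+n-1, b+n-1, c+r) the coefficients have the right sizes, the moments of
order k < n-1 are zero, and the moment of order n-1 is (-1)^(n-1) (n-1)! times
the total mass ([rodrigues_pair]).

The type I function is unique.  The k-th moment of P V_c + Q V_(c+1) is
m_(c+r)(k) times the value at k of a polynomial of degree < n
([moment_polynomialE], [size_moment_polynomial]).  If n moments vanish, this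
polynomial is zero.  Modulo (X+a+1)(X+b+1) only the constant coefficients of P
and Q survive, in a polynomial of degree at most one times factors
X+c+b+1+l with l > 0.  These factors are coprime to X+a+1 and X+b+1 because
c + b > a and c > 0, so both constant coefficients vanish, and one continues
with the next pair ([moment_polynomial_eq0]). *)

(** * The integrand of the Tricomi function *)

Section kernel.
Context {R : realType}.
Implicit Types (p q x t : R).
Local Notation mu := (@lebesgue_measure R).
Local Notation D := (`]0%R, +oo[%classic : set R).

(** The power of t is written p - 1 so that convergence at 0 means 0 < p; p and q
are independent, which makes both Gamma (q = 0) and the integrands of the beta
integral (x = 0) special cases. *)
Definition tricomi_kernel p q x t : R :=
  t `^ (p - 1) * (t + 1) `^ q * expR (- (t * x)).

Definition tricomi_integral p q x : R :=
  \int[mu]_(t in D) tricomi_kernel p q x t.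

Lemma tricomi_kernel_ge0 p q x t : 0 <= tricomi_kernel p q x t.
Proof. by rewrite !mulr_ge0 ?powR_ge0 ?expR_ge0. Qed.

Lemma measurable_tricomi_kernel p q x (E : set R) :
  measurable_fun E (tricomi_kernel p q x).
Proof.
apply: measurable_funTS; apply: measurable_funM; first apply: measurable_funM.
- exact: measurable_powR.
- apply: (@measurableT_comp _ _ _ _ _ _ (fun y => y `^ q) _ (fun t => t + 1)).
    exact: measurable_powR.
  exact: measurable_funD.
- apply: measurableT_comp => //; apply: measurableT_comp => //.
  exact: measurable_funM.
Qed.

(** For q > 0 this is ln y < y at y = (t + 1) x / q; otherwise 1 is a bound. *)
Lemma powR_expR_bounded q x : 0 < x ->
  exists2 C, 0 < C & forall t, 0 <= t -> (t + 1) `^ q * expR (- (t * x)) <= C.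
Proof.
move=> x0; have [q0|q0] := leP q 0.
  exists 1 => // t t0; rewrite mulr_ile1 ?powR_ge0 ?expR_ge0//.
    by apply: le_trans (ler_powR _ q0) _; rewrite ?powRr0 ?lerDr.
  by rewrite expR_le1 oppr_le0 mulr_ge0// ltW.
exists (expR (x - q * ln (x / q))); first exact: expR_gt0.
move=> t t0; have t1 : 0 < t + 1 by rewrite ltr_wpDl.
have xq : 0 < x / q by rewrite divr_gt0.
rewrite /powR gt_eqF// -expRD ler_expR.
have := @ln_sublinear R ((t + 1) * (x / q)); rewrite mulr_gt0// => /(_ isT).
rewrite lnM ?posrE//; set u := ln (t + 1); set v := ln (x / q) => uv.
have : q * (u + v) <= q * ((t + 1) * (x / q)) by rewrite ler_pM2l// ltW.
have -> : q * ((t + 1) * (x / q)) = (t + 1) * x by field; rewrite gt_eqF.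
by rewrite mulrDr; lra.
Qed.

(** The exponential dominates every power of t + 1.  The exponent - p - 1 is chosen
because the right-hand kernel then has an elementary primitive,
(t / (t + 1))^p / p. *)
Lemma tricomi_kernel_bound p q x : 0 < x ->
  exists2 C, 0 < C & forall t, 0 < t ->
    tricomi_kernel p q x t <= C * tricomi_kernel p (- p - 1) 0 t.
Proof.
move=> x0; have [C C0 HC] := powR_expR_bounded (q + p + 1) _ x0.
exists C => // t t0; rewrite /tricomi_kernel mulr0 oppr0 expR0 mulr1.
have t1 : t + 1 != 0 by rewrite gt_eqF// ltr_wpDr// ltW.
have -> : (t + 1) `^ q = (t + 1) `^ (q + p + 1) * (t + 1) `^ (- p - 1).
  by rewrite -powRD ?t1 ?implybT//; congr powR; ring.
have := HC t (ltW t0); set A := _ `^ (p - 1); set B := _ `^ (q + p + 1).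
set E := _ `^ (- p - 1); set e := expR _ => h.
have -> : A * (B * E) * e = (B * e) * (A * E) by ring.
by rewrite ler_wpM2r// mulr_ge0 ?powR_ge0.
Qed.

Lemma is_derive_tricomi_kernel p q x t : 0 < t ->
  is_derive t 1 (tricomi_kernel (p + 1) q x)
    (p * tricomi_kernel p q x t + q * tricomi_kernel (p + 1) (q - 1) x t
     - x * tricomi_kernel (p + 1) q x t).
Proof.
move=> t0; have t1 : 0 < t + 1 by rewrite ltr_wpDr// ltW.
have H1 : is_derive t 1 (fun t => t `^ (p + 1 - 1)) (p * t `^ (p - 1)).
  by apply: is_derive_eq (is_derive1_powR _ t0) _; rewrite addrK.
have H2 : is_derive t 1 (fun t => (t + 1) `^ q) (q * (t + 1) `^ (q - 1)).
  have := @is_derive1_comp R (fun y => y `^ q) (fun t => t + 1) t _ 1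
    (is_derive1_powR q t1).
  by rewrite mulr1; apply; apply: is_derive_eq; rewrite addr0.
have H3 : is_derive t 1 (fun t => expR (- (t * x))) (- x * expR (- (t * x))).
  have := @is_derive1_comp R expR (fun t => - (t * x)) t _ (- x)
    (is_derive_expR _).
  rewrite mulrC; apply; apply: is_derive_eq.
  by rewrite scaler0 add0r /GRing.scale/= mulr1.
have H := is_deriveM (is_deriveM H1 H2) H3.
apply: (is_derive_eq H); rewrite /tricomi_kernel /GRing.scale/= !fctE/= addrK.
by ring.
Qed.

Lemma continuous_tricomi_kernel p q x : {in D, continuous (tricomi_kernel p q x)}.
Proof.
move=> t; rewrite inE/= in_itv/= andbT => t0.
apply/differentiable_continuous/derivable1_diffP.
have := is_derive_tricomi_kernel (p - 1) q x _ t0.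
by rewrite subrK => h; exact: ex_derive.
Qed.

End kernel.

(** * Integrals of derivatives over the half-line *)

Section half_line.
Context {R : realType}.
Implicit Types (f F : R -> R).
Local Notation mu := (@lebesgue_measure R).
Local Notation D := (`]0%R, +oo[%classic : set R).

(** The index starts at 2 so that every interval has distinct endpoints. *)
Definition compact_exhaustion (n : nat) : set R := `[n.+2%:R^-1, n.+2%:R]%classic.
Local Notation S := compact_exhaustion.

Lemma compact_exhaustion_subset n : S n `<=` D.
Proof.
move=> x; rewrite /S/= !in_itv/= andbT => /andP[+ _].
by apply: lt_le_trans; rewrite invr_gt0 ltr0n.
Qed.

Lemma bigcup_compact_exhaustion : \bigcup_n S n = D.
Proof.
apply/seteqP; split => [x [n _]|x]; first exact: compact_exhaustion_subset.
rewrite /= in_itv/= andbT => x0.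
pose n := Num.bound (x + x^-1).
have xn : x + x^-1 < n%:R.
  by apply: archi_boundP; rewrite addr_ge0 ?invr_ge0 ?ltW.
have xi0 : 0 < x^-1 by rewrite invr_gt0.
have nn : n%:R <= n.+2%:R :> R by rewrite ler_nat ltnW.
exists n => //; rewrite /S/= in_itv/=; apply/andP; split; last by lra.
by rewrite -[leRHS]invrK lef_pV2 ?posrE ?ltr0n//; lra.
Qed.

Lemma compact_exhaustion_nondecreasing : nondecreasing_seq S.
Proof.
move=> m n mn; rewrite subsetEset => x; rewrite /S/= !in_itv/= => /andP[h1 h2].
have h : m.+2%:R <= n.+2%:R :> R by rewrite ler_nat.
rewrite (le_trans h2 h) andbT; apply: le_trans h1.
by rewrite lef_pV2 ?posrE ?ltr0n.
Qed.

Lemma cvg_ge0_integral_compact_exhaustion (g : R -> \bar R) :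
  measurable_fun D g -> (forall x, 0 < x -> (0 <= g x)%E) ->
  (\int[mu]_(x in S n) g x @[n --> \oo] --> \int[mu]_(x in D) g x)%E.
Proof.
move=> mg g0; rewrite -bigcup_compact_exhaustion.
apply: ge0_nondecreasing_set_cvg_integral.
- exact: compact_exhaustion_nondecreasing.
- by move=> n; exact: measurable_itv.
- by move=> n; exact: measurable_funS (@compact_exhaustion_subset n) mg.
- move=> n x /compact_exhaustion_subset; rewrite /= in_itv/= andbT.
  exact: g0.
Qed.

Lemma cvg_integral_compact_exhaustion (g : R -> \bar R) :
  mu.-integrable D g ->
  (\int[mu]_(x in S n) g x @[n --> \oo] --> \int[mu]_(x in D) g x)%E.
Proof.
move=> gi; have mg := measurable_int mu gi.
rewrite [X in _ --> X]integralE.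
under eq_cvg do rewrite integralE.
apply: cvgeB.
- rewrite fin_num_adde_defr//; exact: integrable_pos_fin_num.
- by apply: cvg_ge0_integral_compact_exhaustion => //; exact: measurable_funepos.
- by apply: cvg_ge0_integral_compact_exhaustion => //; exact: measurable_funeneg.
Qed.

Lemma integral_derivative_compact_exhaustion f F n :
  {in D, continuous f} -> (forall t : R, 0 < t -> is_derive t 1 F (f t)) ->
  (\int[mu]_(x in S n) (f x)%:E = (F n.+2%:R - F n.+2%:R^-1)%:E)%E.
Proof.
move=> cf dF.
have S0 x : n.+2%:R^-1 <= x -> 0 < x.
  by apply: lt_le_trans; rewrite invr_gt0 ltr0n.
have cF x : 0 < x -> {for x, continuous F}.
  by move=> /dF h; apply/differentiable_continuous/derivable1_diffP; exact: ex_derive.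
have ab : n.+2%:R^-1 < n.+2%:R :> R.
  by apply: (@lt_trans _ _ 1); rewrite ?invf_lt1 ?ltr0n// ltr1n.
rewrite EFinB; apply: continuous_FTC2 => //.
- apply/continuous_in_subspaceT => x; rewrite inE => /compact_exhaustion_subset Dx.
  by apply: cf; rewrite inE.
- split.
  + move=> x; rewrite in_itv/= => /andP[/ltW/S0/dF h _]; exact: ex_derive.
  + by apply/cvg_at_right_filter/cF; rewrite S0.
  + by apply/cvg_at_left_filter/cF; rewrite S0// ltW.
- move=> x; rewrite in_itv/= => /andP[/ltW/S0/dF h _].
  by rewrite derive1E derive_val.
Qed.

(** The integrals over the exhaustion are differences of values of the primitive,
hence bounded, and converge to the integral by monotone convergence. *)
Lemma integrable_bounded_primitive f F M :
  {in D, continuous f} -> (forall t, 0 < t -> 0 <= f t) ->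
  (forall t : R, 0 < t -> is_derive t 1 F (f t)) ->
  (forall t, 0 < t -> 0 <= F t <= M) ->
  mu.-integrable D (EFin \o f).
Proof.
move=> cf f0 dF FM.
have mf : measurable_fun D f.
  by apply: open_continuous_measurable_fun => //; exact: interval_open.
have f0' t : 0 < t -> (0 <= (f t)%:E)%E by move=> /f0; rewrite lee_fin.
apply/integrableP; split; first exact/measurable_EFinP.
have -> : (\int[mu]_(x in D) `|(EFin \o f) x| = \int[mu]_(x in D) (f x)%:E)%E.
  apply: eq_integral => t; rewrite inE/= in_itv/= andbT => t0.
  by rewrite ger0_norm// f0.
have mf' : measurable_fun D (EFin \o f) by exact/measurable_EFinP.
have h := cvg_ge0_integral_compact_exhaustion _ mf' f0'.
apply: (@le_lt_trans _ _ M%:E); last by rewrite ltry.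
rewrite -(cvg_lim _ h)//; apply: lime_le; first by apply/cvg_ex; eexists; exact: h.
apply: nearW => n; rewrite (integral_derivative_compact_exhaustion _ F)// lee_fin.
have /andP[_ ?] := FM n.+2%:R (ltr0Sn _ _).
have /andP[? _] : 0 <= F n.+2%:R^-1 <= M by rewrite FM// invr_gt0 ltr0n.
lra.
Qed.

(** This is the form of the fundamental theorem that integration by parts uses, when
the boundary terms vanish at both ends. *)
Lemma Rintegral_derivative_eq0 f F :
  mu.-integrable D (EFin \o f) -> {in D, continuous f} ->
  (forall t : R, 0 < t -> is_derive t 1 F (f t)) ->
  F n.+2%:R @[n --> \oo] --> 0 -> F n.+2%:R^-1 @[n --> \oo] --> 0 ->
  \int[mu]_(t in D) f t = 0.
Proof.
move=> fi cf dF Foo F0; have h := cvg_integral_compact_exhaustion _ fi.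
have h2 : (F n.+2%:R - F n.+2%:R^-1)%:E @[n --> \oo] --> 0%:E.
  by apply: cvg_EFin; [exact: nearW|rewrite -(subr0 0); exact: cvgB].
rewrite /Rintegral -[RHS]/(fine 0%:E); congr fine.
have h' : (\int[mu]_(x in S n) (EFin \o f) x @[n --> \oo] --> 0%:E)%E.
  rewrite [X in X @ _ --> _](_ : _ = (fun n => (F n.+2%:R - F n.+2%:R^-1)%:E))//.
  apply/funext => n.
  by rewrite -(integral_derivative_compact_exhaustion f F).
exact: cvg_unique h h'.
Qed.

End half_line.

(** * The Tricomi integral: convergence, integration by parts, derivative *)

Section tricomi_integral.
Context {R : realType}.
Implicit Types (p q x t : R).
Local Notation mu := (@lebesgue_measure R).
Local Notation D := (`]0%R, +oo[%classic : set R).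

Lemma half_line_gt0 t : D t -> 0 < t.
Proof. by rewrite /= in_itv/= andbT. Qed.

(** The primitive is (t / (t + 1))^p / p, which stays between 0 and 1 / p. *)
Lemma integrable_algebraic_kernel p : 0 < p ->
  mu.-integrable D (EFin \o tricomi_kernel p (- p - 1) 0).
Proof.
move=> p0.
apply: (integrable_bounded_primitive _
  (fun t => p^-1 * tricomi_kernel (p + 1) (- p) 0 t) (p^-1)).
- exact: continuous_tricomi_kernel.
- by move=> t _; exact: tricomi_kernel_ge0.
- move=> t t0.
  have t1 : 0 < t + 1 by rewrite ltr_wpDr// ltW.
  have H := is_deriveZ p^-1
    (is_derive_tricomi_kernel p (- p) 0 _ t0).
  apply: (is_derive_eq H).
  rewrite /tricomi_kernel !mulr0 oppr0 expR0 !mulr1 mul0r subr0 addrK.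
  have -> : t `^ p = t * t `^ (p - 1) by rewrite mulr_powRB1// ltW.
  have -> : (t + 1) `^ (- p) = (t + 1) * (t + 1) `^ (- p - 1).
    rewrite -{2}(powRr1 (ltW t1)) -powRD; last by rewrite (gt_eqF t1) implybT.
    by congr powR; ring.
  by rewrite /GRing.scale/=; field; rewrite gt_eqF.
- move=> t t0; have t1 : 0 < t + 1 by rewrite ltr_wpDr// ltW.
  rewrite mulr_ge0 ?tricomi_kernel_ge0 ?invr_ge0 ?(ltW p0)//=.
  rewrite -[leRHS]mulr1 ler_wpM2l ?invr_ge0 ?(ltW p0)//.
  rewrite /tricomi_kernel addrK mulr0 oppr0 expR0 mulr1 powRN.
  rewrite ler_pdivrMr ?powR_gt0// mul1r.
  by apply: ge0_ler_powR; rewrite ?nnegrE ?ltW// ltrDl.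
Qed.

Lemma integrable_tricomi_kernel p q x : 0 < p -> 0 < x ->
  mu.-integrable D (EFin \o tricomi_kernel p q x).
Proof.
move=> p0 x0; have [C C0 HC] := tricomi_kernel_bound p q _ x0.
have mD : measurable (D : set (measurableTypeR R)) by exact: measurable_itv.
apply: (le_integrable mD _ _ (integrableZl mD C (integrable_algebraic_kernel p p0))).
- by apply/measurable_EFinP; exact: measurable_tricomi_kernel.
- move=> t /half_line_gt0 t0 /=; rewrite lee_fin ger0_norm ?tricomi_kernel_ge0//.
  rewrite (le_trans (HC _ t0))// ler_norm//.
Qed.

Lemma cvg_invnS2 : n.+2%:R^-1 @[n --> \oo] --> (0 : R).
Proof. by have := @cvg_harmonic R; rewrite -cvg_shiftS; exact. Qed.

Lemma cvg_tricomi_kernel_infty p q x : 0 < p -> 0 < x ->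
  tricomi_kernel (p + 1) q x n.+2%:R @[n --> \oo] --> 0.
Proof.
move=> p0 x0; have [C C0 HC] := tricomi_kernel_bound (p + 1) q _ x0.
apply: (@squeeze_cvgr _ _ _ _ (fun=> 0) (fun n => C * n.+2%:R^-1)).
- apply: nearW => n; rewrite tricomi_kernel_ge0/=.
  have n0 : 0 < n.+2%:R :> R by rewrite ltr0n.
  have n1 : 0 < n.+2%:R + 1 :> R by lra.
  apply: le_trans (HC _ n0) _; rewrite ler_pM2l//.
  rewrite /tricomi_kernel addrK mulr0 oppr0 expR0 mulr1.
  rewrite (_ : - (p + 1) - 1 = - p + (- (1 + 1))); last by ring.
  rewrite powRD; last by rewrite (gt_eqF n1) implybT.
  rewrite !powRN mulrA; apply: (@le_trans _ _ (1 * ((n.+2%:R + 1) `^ (1 + 1))^-1)).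
    rewrite ler_pM2r ?invr_gt0 ?powR_gt0//.
    rewrite ler_pdivrMr ?powR_gt0// mul1r.
    by apply: ge0_ler_powR; rewrite ?nnegrE ?ltW// ltrDl.
  rewrite mul1r lef_pV2 ?posrE ?powR_gt0//.
  rewrite -[1 + 1]/(2%:R) powR_mulrn ?(ltW n1)// expr2.
  by nra.
- exact: cvg_cst.
- by rewrite -(mulr0 C); apply: cvgMr; exact: cvg_invnS2.
Qed.

Lemma cvg_tricomi_kernel_0 p q x : 0 < p -> 0 < x ->
  tricomi_kernel (p + 1) q x n.+2%:R^-1 @[n --> \oo] --> 0.
Proof.
move=> p0 x0; have [C C0 HC] := tricomi_kernel_bound (p + 1) q _ x0.
apply: (@squeeze_cvgr _ _ _ _ (fun=> 0) (fun n => C * (n.+2%:R^-1) `^ p)).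
- apply: nearW => n; rewrite tricomi_kernel_ge0/=.
  have n0 : 0 < n.+2%:R^-1 :> R by rewrite invr_gt0 ltr0n.
  apply: le_trans (HC _ n0) _; rewrite ler_pM2l//.
  rewrite /tricomi_kernel addrK mulr0 oppr0 expR0 mulr1.
  rewrite -[leRHS]mulr1 ler_wpM2l ?powR_ge0//.
  rewrite -[leRHS](powRr0 (n.+2%:R^-1 + 1)) ler_powR//; last by lra.
  by rewrite lerDr ltW.
- exact: cvg_cst.
- rewrite -(mulr0 C); apply: cvgMr.
  have /cvg_at_rightP := powR_cvg0 p0; apply; split; last exact: cvg_invnS2.
  by move=> n; rewrite invr_gt0 ltr0n.
Qed.

(** The derivative of t^p (t+1)^q e^(-t x) integrates to zero. *)
Lemma tricomi_integral_by_parts p q x : 0 < p -> 0 < x ->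
  x * tricomi_integral (p + 1) q x =
  p * tricomi_integral p q x + q * tricomi_integral (p + 1) (q - 1) x.
Proof.
move=> p0 x0; have p1 : 0 < p + 1 by lra.
set f := fun t => p * tricomi_kernel p q x t +
  q * tricomi_kernel (p + 1) (q - 1) x t - x * tricomi_kernel (p + 1) q x t.
have mD : measurable (D : set (measurableTypeR R)) by exact: measurable_itv.
have iZ k p' q' : 0 < p' ->
    mu.-integrable D (EFin \o (fun t => k * tricomi_kernel p' q' x t)).
  move=> p'0.
  exact: (integrableZl mD k (integrable_tricomi_kernel p' q' x p'0 x0)).
have iD : mu.-integrable D (EFin \o (fun t => p * tricomi_kernel p q x t +
    q * tricomi_kernel (p + 1) (q - 1) x t)).
  exact: (integrableD mD (iZ p p q p0) (iZ q (p + 1) (q - 1) p1)).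
have : \int[mu]_(t in D) f t = 0.
  apply: (Rintegral_derivative_eq0 _ (tricomi_kernel (p + 1) q x)).
  - exact: (integrableB mD iD (iZ x (p + 1) q p1)).
  - move=> t Dt; apply: cvgB; [apply: cvgD|]; apply: cvgMr;
      exact: continuous_tricomi_kernel.
  - by move=> t t0; exact: is_derive_tricomi_kernel.
  - exact: cvg_tricomi_kernel_infty.
  - exact: cvg_tricomi_kernel_0.
rewrite RintegralB//; last exact: iZ.
rewrite RintegralD//; [|exact: iZ|exact: iZ].
rewrite !RintegralZl//; try exact: integrable_tricomi_kernel.
by move/eqP; rewrite subr_eq0 => /eqP ->.
Qed.

Lemma tricomi_integralD p q x : 0 < p -> 0 < x ->
  tricomi_integral p (q + 1) x = tricomi_integral p q x + tricomi_integral (p + 1) q x.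
Proof.
move=> p0 x0; rewrite /tricomi_integral -RintegralD//; last 2 first.
- exact: integrable_tricomi_kernel.
- by apply: integrable_tricomi_kernel => //; lra.
apply: eq_Rintegral => t; rewrite inE => /half_line_gt0 t0; rewrite /tricomi_kernel addrK.
have t1 : 0 < t + 1 by lra.
have -> : (t + 1) `^ (q + 1) = (t + 1) `^ q * (t + 1).
  by rewrite powRD ?(gt_eqF t1) ?implybT// powRr1 ?ltW.
by rewrite -(mulr_powRB1 _ p0) ?ltW//; ring.
Qed.

Lemma tricomi_kernel_pos p q x t : 0 < t -> 0 < tricomi_kernel p q x t.
Proof.
by move=> t0; rewrite !mulr_gt0 ?powR_gt0 ?expR_gt0// ltr_wpDr// ltW.
Qed.

(** Differentiation under the integral sign; near x the derivative of the integrand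
is dominated by its value at x / 2. *)
Lemma is_derive_tricomi_integral p q x : 0 < p -> 0 < x ->
  is_derive x 1 (tricomi_integral p q) (- tricomi_integral (p + 1) q x).
Proof.
move=> p0 x0; have p1 : 0 < p + 1 by lra.
have d1 y t : is_derive y (1:R) (fun y => tricomi_kernel p q y t)
    (- t * tricomi_kernel p q y t).
  have H : is_derive y (1:R) (fun y => expR (- (t * y))) (- t * expR (- (t * y))).
    have := @is_derive1_comp R expR (fun y => - (t * y)) y _ (- t) (is_derive_expR _).
    rewrite mulrC; apply; apply: is_derive_eq.
    by rewrite /GRing.scale/=; ring.
  have H' := is_deriveZ (t `^ (p - 1) * (t + 1) `^ q) H.
  by apply: (is_derive_eq H'); rewrite /tricomi_kernel /GRing.scale/=; ring.
have Ix : `]x / 2, (2 * x)[%classic x by rewrite /= in_itv/=; lra.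
have Iint y : `]x / 2, (2 * x)[%classic y ->
    mu.-integrable D (EFin \o tricomi_kernel p q y).
  rewrite /= in_itv/= => /andP[y0 _]; apply: integrable_tricomi_kernel => //; lra.
have Ider y t : `]x / 2, (2 * x)[%classic y -> D t ->
    derivable (fun y => tricomi_kernel p q y t) y 1.
  by move=> _ _; have h := d1 y t; exact: ex_derive.
have IG : mu.-integrable D (EFin \o tricomi_kernel (p + 1) q (x / 2)).
  by apply: integrable_tricomi_kernel => //; lra.
have tK y t : 0 < t -> t * tricomi_kernel p q y t = tricomi_kernel (p + 1) q y t.
  by move=> t0; rewrite /tricomi_kernel addrK -(mulr_powRB1 _ p0) ?ltW//; ring.
have dE y t : partial1of2 (tricomi_kernel p q) y t = - t * tricomi_kernel p q y t.
  by rewrite partial1of2E; have h := d1 y t; rewrite derive_val.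
have Ibd y t : `]x / 2, (2 * x)[%classic y -> D t ->
    `|partial1of2 (tricomi_kernel p q) y t| <= tricomi_kernel (p + 1) q (x / 2) t.
  rewrite /= in_itv/= => /andP[y0 _] /half_line_gt0 t0.
  rewrite dE mulNr normrN tK// ger0_norm ?tricomi_kernel_ge0//.
  by rewrite ler_wpM2l ?mulr_ge0 ?powR_ge0// ler_expR lerN2 ler_pM2l// ltW.
have Gge := tricomi_kernel_ge0 (p + 1) q (x / 2).
have mD : measurable (D : set (measurableTypeR R)) by exact: measurable_itv.
have hD : derivable (tricomi_integral p q) x 1.
  exact: (derivable_under_integral (mu := mu) mD Ix Iint Ider Gge IG Ibd).
have hE : derive1 (tricomi_integral p q) x =
    \int[mu]_(t in D) partial1of2 (tricomi_kernel p q) x t.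
  exact: (differentiation_under_integral (mu := mu) mD Ix Iint Ider Gge IG Ibd).
apply: DeriveDef; first exact: hD.
rewrite -derive1E hE -mulN1r -RintegralZl//; last exact: integrable_tricomi_kernel.
apply: eq_Rintegral => t; rewrite inE => /half_line_gt0 t0.
by rewrite dE -tK// mulN1r mulNr.
Qed.

Lemma GammaE p : Gamma p = tricomi_integral p 0 1.
Proof.
apply: eq_Rintegral => t _; rewrite /tricomi_kernel powRr0 mulr1.
by rewrite mulr1.
Qed.

Lemma Gamma_add1 p : 0 < p -> Gamma (p + 1) = p * Gamma p.
Proof.
move=> p0; have := tricomi_integral_by_parts _ 0 _ p0 (@ltr01 R).
by rewrite mul1r mul0r addr0 !GammaE.
Qed.

End tricomi_integral.

(** * The Gamma function and the beta integral *)

Section moments.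
Context {R : realType}.
Implicit Types (p q x t a b c s : R).
Local Notation mu := (@lebesgue_measure R).
Local Notation D := (`]0%R, +oo[%classic : set R).

Lemma eq_integral_half_line (g f : R -> \bar R) :
  (forall x, 0 < x -> f x = g x) ->
  (\int[mu]_(x in D) f x = \int[mu]_(x in D) g x)%E.
Proof. by move=> fg; apply: eq_integral => x; rewrite inE => /half_line_gt0 /fg. Qed.

(** A nonnegative function with zero integral vanishes almost everywhere, while this
integrand is positive on a set of infinite measure. *)
Lemma Gamma_gt0 p : 0 < p -> 0 < Gamma p.
Proof.
move=> p0; rewrite GammaE lt_neqAle Rintegral_ge0 ?andbT; last first.
  by move=> t _; exact: tricomi_kernel_ge0.
have mD : measurable (D : set (measurableTypeR R)) by exact: measurable_itv.
have iK := integrable_tricomi_kernel p 0 1 p0 ltr01.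
apply/negP => /eqP /esym h.
have : (\int[mu]_(t in D) `|(tricomi_kernel p 0 1 t)%:E| = 0)%E.
  rewrite (eq_integral_half_line (fun t => (tricomi_kernel p 0 1 t)%:E)); last first.
    by move=> t _; rewrite /= ger0_norm ?tricomi_kernel_ge0.
  by rewrite -[LHS]fineK ?[fine _]h//; exact: integrable_fin_num.
move/(ae_eq_integral_abs mu mD (measurable_int mu iK)).
move=> [N [mN N0 DN]].
have : (mu D <= 0)%E.
  rewrite -[leRHS]N0; apply: le_measure; rewrite ?inE//.
  move=> t Dt; apply: DN => /= /(_ Dt)/eqP.
  by rewrite eqe gt_eqF// tricomi_kernel_pos//; exact: half_line_gt0.
by rewrite lebesgue_measure_itv/= ltry.
Qed.

(** By parts, x^p times the left-hand side has derivative zero.  The proof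
substitutes x = e^u to have a function on the whole line. *)
Lemma laplace_powR p x : 0 < p -> 0 < x ->
  tricomi_integral p 0 x = x `^ (- p) * Gamma p.
Proof.
move=> p0 x0.
pose h u := expR (u * p) * tricomi_integral p 0 (expR u).
have dh (u : R) : is_derive u (1:R) h 0.
  have H1 : is_derive u (1:R) (fun u => expR (u * p)) (p * expR (u * p)).
    have := @is_derive1_comp R expR (fun u => u * p) u _ p (is_derive_expR _).
    rewrite mulrC; apply; apply: is_derive_eq.
    by rewrite /GRing.scale/=; ring.
  have H2 := @is_derive1_comp R (tricomi_integral p 0) expR u _ _
    (is_derive_tricomi_integral p 0 _ p0 (expR_gt0 u)) (is_derive_expR u).
  apply: (is_derive_eq (is_deriveM H1 H2)).
  have := tricomi_integral_by_parts p 0 _ p0 (expR_gt0 u).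
  rewrite /GRing.scale/= => E.
  rewrite mulNr [tricomi_integral (p + 1) 0 _ * _]mulrC E.
  by ring.
have := is_derive_0_is_cst (ln x) 0 dh.
rewrite /h lnK ?posrE// mul0r !expR0 mul1r -GammaE => <-.
by rewrite mulrA powRN /powR gt_eqF// [ln x * p]mulrC mulVf ?mul1r// gt_eqF// expR_gt0.
Qed.

Lemma integral_tricomi_kernel p q x : 0 < p -> 0 < x ->
  (\int[mu]_(t in D) (tricomi_kernel p q x t)%:E = (tricomi_integral p q x)%:E)%E.
Proof.
move=> p0 x0; rewrite /tricomi_integral /Rintegral fineK//.
by apply: integrable_fin_num => //; exact: integrable_tricomi_kernel.
Qed.

Lemma tonelli_quadrant (f : R -> R -> R) (g h : R -> R) :
  (forall x t, 0 <= f x t) ->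
  measurable_fun setT (fun z : R * R => f z.1 z.2) ->
  (forall x, 0 < x -> (\int[mu]_(t in D) (f x t)%:E = (g x)%:E)%E) ->
  (forall t, 0 < t -> (\int[mu]_(x in D) (f x t)%:E = (h t)%:E)%E) ->
  (\int[mu]_(x in D) (g x)%:E = \int[mu]_(t in D) (h t)%:E)%E.
Proof.
move=> f0 mf Hg Hh.
pose F (z : R * R) : \bar R := (f z.1 z.2 * (\1_D z.1 * \1_D z.2))%:E.
have mF : measurable_fun setT F.
  apply/measurable_EFinP; apply: measurable_funM => //; apply: measurable_funM.
    exact: (measurableT_comp (measurable_indic (measurable_itv _)) measurable_fst).
  exact: (measurableT_comp (measurable_indic (measurable_itv _)) measurable_snd).
have F0 z : (0 <= F z)%E by rewrite lee_fin !mulr_ge0.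
have := fubini_tonelli (m1 := mu) (m2 := mu) F mF F0.
have -> : (\int[mu]_x \int[mu]_y F (x, y) = \int[mu]_(x in D) (g x)%:E)%E.
  rewrite [RHS]integral_mkcond; apply: eq_integral => x _.
  rewrite patchE; case: ifPn => [|/negbTE] xD.
    rewrite -Hg; last by apply: half_line_gt0; exact: set_mem xD.
    rewrite [RHS]integral_mkcond; apply: eq_integral => t _.
    rewrite /F/= patchE indicE xD mul1r indicE.
    by case: ifPn => _; rewrite ?mulr1 ?mulr0.
  by apply: integral0_eq => t _; rewrite /F/= indicE xD mul0r mulr0.
have -> : (\int[mu]_y \int[mu]_x F (x, y) = \int[mu]_(t in D) (h t)%:E)%E.
  rewrite [RHS]integral_mkcond; apply: eq_integral => t _.
  rewrite patchE; case: ifPn => [|/negbTE] tD.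
    rewrite -Hh; last by apply: half_line_gt0; exact: set_mem tD.
    rewrite [RHS]integral_mkcond; apply: eq_integral => x _.
    rewrite /F/= patchE [\1_D t]indicE tD mulr1 indicE.
    by case: ifPn => _; rewrite ?mulr1 ?mulr0.
  by apply: integral0_eq => x _; rewrite /F/= [\1_D t]indicE tD !mulr0.
by [].
Qed.

(** Integrate x^a e^(-x) t^(c-1) (t+1)^q e^(-t x) over the quadrant in both orders.
The order x first is a Gamma integral scaled by t + 1. *)
Lemma integral_powR_exp_tricomi a c q : -1 < a -> 0 < c ->
  (\int[mu]_(x in D) (x `^ a * expR (- x) * tricomi_integral c q x)%:E =
   \int[mu]_(t in D) (Gamma (a + 1) * tricomi_kernel c (q - a - 1) 0 t)%:E)%E.
Proof.
move=> a1 c0; have a0 : 0 < a + 1 by lra.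
have mD : measurable (D : set (measurableTypeR R)) by exact: measurable_itv.
apply: (tonelli_quadrant (fun x t => x `^ a * expR (- x) * tricomi_kernel c q x t)).
- by move=> x t; rewrite !mulr_ge0 ?powR_ge0 ?expR_ge0.
- have mp b : measurable_fun [set: R] (fun y : R => y `^ b) := measurable_powR b.
  rewrite /tricomi_kernel; repeat apply: measurable_funM.
  + by apply: (measurableT_comp (mp a)).
  + by apply: measurableT_comp => //; apply: measurableT_comp => //.
  + by apply: (measurableT_comp (mp (c - 1))).
  + apply: (measurableT_comp (mp q)).
    exact: measurable_funD.
  + apply: measurableT_comp => //; apply: measurableT_comp => //.
    exact: measurable_funM.
- move=> x x0; under eq_integral do rewrite EFinM.
  rewrite ge0_integralZl_EFin//.
  + by rewrite integral_tricomi_kernel.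
  + by move=> t _; rewrite lee_fin tricomi_kernel_ge0.
  + by apply/measurable_EFinP; exact: measurable_tricomi_kernel.
  + by rewrite mulr_ge0 ?powR_ge0 ?expR_ge0.
- move=> t t0; have t1 : 0 < t + 1 by lra.
  rewrite (eq_integral_half_line (fun x => (tricomi_kernel c q 0 t)%:E *
    (tricomi_kernel (a + 1) 0 (t + 1) x)%:E)%E); last first.
    move=> x _; rewrite -EFinM /tricomi_kernel addrK powRr0 !mulr0 oppr0 expR0.
    have -> : expR (- (x * (t + 1))) = expR (- x) * expR (- (t * x)).
      by rewrite -expRD; congr expR; ring.
    by congr EFin; ring.
  rewrite ge0_integralZl_EFin//.
  + rewrite integral_tricomi_kernel// laplace_powR// -EFinM; congr EFin.
    rewrite /tricomi_kernel !mulr0.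
    have -> : (t + 1) `^ (q - a - 1) = (t + 1) `^ q * (t + 1) `^ (- (a + 1)).
      by rewrite -powRD ?(gt_eqF t1) ?implybT//; congr powR; ring.
    by ring.
  + by move=> x _; rewrite lee_fin tricomi_kernel_ge0.
  + by apply/measurable_EFinP; exact: measurable_tricomi_kernel.
  + exact: tricomi_kernel_ge0.
Qed.

(** The case q = 0 of the previous lemma: there the inner integral in t is itself
a scaled Gamma integral, so both sides become explicit. *)
Lemma beta_integral c s : 0 < c -> 0 < s ->
  (\int[mu]_(t in D) (tricomi_kernel c (- (c + s)) 0 t)%:E =
   (Gamma c * Gamma s / Gamma (c + s))%:E)%E.
Proof.
move=> c0 s0; have cs0 : 0 < c + s by lra.
have G0 := Gamma_gt0 _ cs0.
have mD : measurable (D : set (measurableTypeR R)) by exact: measurable_itv.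
have a1 : -1 < c + s - 1 by lra.
have := integral_powR_exp_tricomi _ _ 0 a1 c0.
rewrite subrK (_ : 0 - (c + s - 1) - 1 = - (c + s)); last by ring.
rewrite (eq_integral_half_line (fun x => (Gamma c)%:E * (tricomi_kernel s 0 1 x)%:E)%E); last first.
  move=> x x0; rewrite laplace_powR// -EFinM; congr EFin.
  rewrite /tricomi_kernel powRr0 !mulr1.
  have -> : x `^ (s - 1) = x `^ (c + s - 1) * x `^ (- c).
    by rewrite -powRD ?(gt_eqF x0) ?implybT//; congr powR; ring.
  by ring.
rewrite ge0_integralZl_EFin//; last 3 first.
- by move=> x _; rewrite lee_fin tricomi_kernel_ge0.
- by apply/measurable_EFinP; exact: measurable_tricomi_kernel.
- by rewrite ltW// Gamma_gt0.
rewrite (integral_tricomi_kernel s 0 1)// -GammaE -EFinM.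
under [X in _ = X -> _]eq_integral do rewrite EFinM.
rewrite ge0_integralZl_EFin//; last 3 first.
- by move=> x _; rewrite lee_fin tricomi_kernel_ge0.
- by apply/measurable_EFinP; exact: measurable_tricomi_kernel.
- by rewrite ltW// Gamma_gt0.
move=> E; rewrite [RHS]EFinM E muleAC -EFinM mulfV ?gt_eqF//.
by rewrite mul1e.
Qed.

End moments.

(** * The weight: derivatives, contiguous relation and total mass *)

Section weight.
Context {R : realType}.
Implicit Types (x t a b c : R).
Local Notation mu := (@lebesgue_measure R).
Local Notation D := (`]0%R, +oo[%classic : set R).

Definition unnormalized_weight a b c x : R :=
  expR (- x) * x `^ a * tricomi c (a - b + 1) x.
Local Notation V := unnormalized_weight.

Lemma unnormalized_weightE a b c x :
  V a b c x = (Gamma c)^-1 * (x `^ a * expR (- x) * tricomi_integral c (a - b - c) x).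
Proof.
rewrite /V /tricomi (_ : a - b + 1 - c - 1 = a - b - c); last by ring.
by rewrite -/(tricomi_kernel _ _ _) -/(tricomi_integral _ _ _); ring.
Qed.

(** The Tricomi factor depends on a and b only through a - b. *)
Lemma unnormalized_weight_shift a b c x : 0 < x ->
  V (a + 1) (b + 1) c x = x * V a b c x.
Proof.
move=> x0; rewrite /V (_ : a + 1 - (b + 1) + 1 = a - b + 1); last by ring.
have -> : x `^ (a + 1) = x * x `^ a.
  by rewrite powRD ?(gt_eqF x0) ?implybT// powRr1 ?ltW// mulrC.
by ring.
Qed.

Lemma unnormalized_weight_shiftn a b c x n : 0 < x ->
  V (a + n%:R) (b + n%:R) c x = x ^+ n * V a b c x.
Proof.
move=> x0; elim: n => [|n IH]; first by rewrite !addr0 expr0 mul1r.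
by rewrite -natr1 !addrA unnormalized_weight_shift// IH exprS mulrA.
Qed.

Lemma is_derive_unnormalized_weight_aux a b c x : 0 < c -> 0 < x ->
  is_derive x 1 (V (a + 1) (b + 1) c)
    ((Gamma c)^-1 * (x `^ a * expR (- x) *
     ((a + 1 - x) * tricomi_integral c (a - b - c) x -
      x * tricomi_integral (c + 1) (a - b - c) x))).
Proof.
move=> c0 x0.
have -> : V (a + 1) (b + 1) c = fun x => (Gamma c)^-1 *
    (x `^ (a + 1) * expR (- x) * tricomi_integral c (a - b - c) x).
  apply/funext => y; rewrite unnormalized_weightE.
  by rewrite (_ : a + 1 - (b + 1) - c = a - b - c); last by ring.
have H1 : is_derive x (1:R) (fun x => x `^ (a + 1)) ((a + 1) * x `^ a).
  by apply: is_derive_eq (is_derive1_powR _ x0) _; rewrite addrK.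
have H2 : is_derive x (1:R) (fun x => expR (- x)) (- expR (- x)).
  have := @is_derive1_comp R expR (fun x => - x) x _ (- 1) (is_derive_expR _).
  by rewrite mulrN1; apply; apply: is_derive_eq.
have H3 := is_derive_tricomi_integral c (a - b - c) _ c0 x0.
apply: (is_derive_eq (is_deriveZ (Gamma c)^-1 (is_deriveM (is_deriveM H1 H2) H3))).
rewrite /GRing.scale/= !fctE.
have -> : x `^ (a + 1) = x `^ a * x.
  by rewrite powRD ?(gt_eqF x0) ?implybT// powRr1 ?ltW.
by ring.
Qed.

(** Together with the next lemma this is the first order system satisfied by
x V_c and x V_(c+1). *)
Lemma is_derive_unnormalized_weight a b c x : 0 < c -> 0 < x ->
  is_derive x 1 (V (a + 1) (b + 1) c)
    ((a + 1 - c - x) * V a b c x + c * (c + b - a) * V a b (c + 1) x).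
Proof.
move=> c0 x0; have G0 := Gamma_gt0 _ c0.
apply: (is_derive_eq (is_derive_unnormalized_weight_aux _ _ _ _ c0 x0)).
rewrite (tricomi_integral_by_parts _ _ _ c0 x0) !unnormalized_weightE Gamma_add1//.
rewrite (_ : a - b - (c + 1) = a - b - c - 1); last by ring.
by field; rewrite !gt_eqF.
Qed.

Lemma is_derive_unnormalized_weightS a b c x : 0 < c -> 0 < x ->
  is_derive x 1 (V (a + 1) (b + 1) (c + 1))
    ((c + b + 1) * V a b (c + 1) x - V a b c x).
Proof.
move=> c0 x0; have G0 := Gamma_gt0 _ c0; have c1 : 0 < c + 1 by lra.
apply: (is_derive_eq (is_derive_unnormalized_weight_aux _ _ _ _ c1 x0)).
have := tricomi_integral_by_parts c (a - b - c) _ c0 x0.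
have := tricomi_integralD (c + 1) (a - b - c - 1) _ c1 x0.
rewrite subrK !unnormalized_weightE Gamma_add1//.
rewrite (_ : a - b - (c + 1) = a - b - c - 1); last by ring.
set J := tricomi_integral _ _ _ => ->.
rewrite mulrDr => /(canRL (addKr _)) ->.
by field; rewrite !gt_eqF.
Qed.

(** Both derivative formulas apply to V(a+1, b+1, c+1); this is their equality. *)
Lemma unnormalized_weight_contiguous a b c x : 0 < c -> 0 < x ->
  (c + 1) * (c + 1 + b - a) * V a b (c + 1 + 1) x =
  (x + b - a + 2 * c + 1) * V a b (c + 1) x - V a b c x.
Proof.
move=> c0 x0; have c1 : 0 < c + 1 by lra.
have h1 := is_derive_unnormalized_weightS a b _ _ c0 x0.
have h2 := is_derive_unnormalized_weight a b _ _ c1 x0.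
have := @derive_val _ _ _ _ _ _ _ h1; rewrite (@derive_val _ _ _ _ _ _ _ h2).
by move=> /(canRL (addKr _)) ->; ring.
Qed.

Lemma integral_unnormalized_weight a b c : -1 < a -> -1 < b -> 0 < c ->
  (\int[mu]_(x in D) (V a b c x)%:E =
   (Gamma (a + 1) * Gamma (b + 1) / Gamma (c + b + 1))%:E)%E.
Proof.
move=> a1 b1 c0; have b0 : 0 < b + 1 by lra. have a0 : 0 < a + 1 by lra.
have G0 := Gamma_gt0 _ c0; have Ga := Gamma_gt0 _ a0.
have mD : measurable (D : set (measurableTypeR R)) by exact: measurable_itv.
have H := integral_powR_exp_tricomi _ _ (a - b - c) a1 c0.
have Gi : (0 <= (Gamma c)^-1)%R by rewrite invr_ge0 ltW.
rewrite (eq_integral_half_line (fun x => (Gamma c)^-1%:E *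
    (x `^ a * expR (- x) * tricomi_integral c (a - b - c) x)%:E)%E); last first.
  by move=> x x0; rewrite -EFinM unnormalized_weightE.
rewrite ge0_integralZl_EFin//; last 2 first.
- move=> x _; rewrite lee_fin !mulr_ge0 ?powR_ge0 ?expR_ge0//.
  by apply: Rintegral_ge0 => t _; exact: tricomi_kernel_ge0.
- apply/measurable_EFinP.
  apply: open_continuous_measurable_fun; first exact: interval_open.
  move=> x; rewrite inE => /half_line_gt0 x0.
  apply/differentiable_continuous/derivable1_diffP.
  apply: derivableM; first apply: derivableM.
  + have h := is_derive1_powR a x0; exact: ex_derive.
  + apply: ex_derive.
  + have h := is_derive_tricomi_integral c (a - b - c) _ c0 x0; exact: ex_derive.
rewrite [X in (_ * X)%E]H.
under eq_integral do rewrite EFinM.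
rewrite ge0_integralZl_EFin//; last 3 first.
- by move=> x _; rewrite lee_fin tricomi_kernel_ge0.
- by apply/measurable_EFinP; exact: measurable_tricomi_kernel.
- by rewrite ltW.
rewrite (_ : a - b - c - a - 1 = - (c + (b + 1))); last by ring.
rewrite beta_integral// -!EFinM; congr EFin; rewrite addrA.
have Gcb : 0 < Gamma (c + b + 1) by apply: Gamma_gt0; lra.
by field; rewrite !gt_eqF.
Qed.

End weight.

(** * Moments as values of a polynomial *)

Section moment_polynomial.
Context {R : realType}.
Implicit Types (a b c al be ga : R) (u v : nat -> R).

(** With al = a + 1, be = b + 1, ga = c + b + 1 this is the polynomial whose value
at k is the k-th moment of the combination with coefficient sequences u and v,
divided by the k-th moment of V_(c+r).  The recursion on r splits off the two
constant coefficients: the other terms carry a factor x, which shifts a and b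
by one. *)
Fixpoint moment_polynomial r al be ga u v : {poly R} :=
  if r is r'.+1 then
    ((u 0)%:P * ('X + ga%:P) + (v 0)%:P) *
      \prod_(l < r') ('X + (ga + l.+1%:R)%:P) +
    ('X + al%:P) * ('X + be%:P) *
      moment_polynomial r' (al + 1) (be + 1) (ga + 1) (u \o S) (v \o S)
  else (u 0)%:P.

Lemma size_linear_poly (x y : R) : (size (x%:P * 'X + y%:P)%R <= 2)%N.
Proof.
apply: leq_trans (size_polyD _ _) _; rewrite geq_max (leq_trans (size_polyC_leq1 _))// andbT.
apply: leq_trans (size_polyMleq _ _) _; rewrite size_polyX.
by rewrite addn2 ltnS size_polyC_leq1.
Qed.

Lemma size_moment_polynomial p r al be ga u v :
  (p <= r.+1)%N -> (r <= p.+1)%N ->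
  (forall i, (p <= i)%N -> u i = 0) -> (forall i, (r <= i)%N -> v i = 0) ->
  (size (moment_polynomial r al be ga u v) <= p + r)%N.
Proof.
elim: r p al be ga u v => [|r IH] p al be ga u v pr rp u0 v0 /=.
  rewrite addn0; case: p pr rp u0 => [|p] _ _ u0; first by rewrite u0// size_poly0.
  by rewrite (leq_trans (size_polyC_leq1 _)).
case: p pr rp u0 => [_|p pr rp u0].
  rewrite ltnS leqn0 => /eqP -> u0 /=.
  rewrite big_ord0 mulr1 !u0// polyC0 mulr0 addr0 mul0r add0r.
  by rewrite add0n size_polyC_leq1.
have sXC (z : R) : size ('X + z%:P) = 2.
  by rewrite -[z]opprK polyCN size_XsubC.
apply: leq_trans (size_polyD _ _) _; rewrite geq_max; apply/andP; split.
  apply: leq_trans (size_polyMleq _ _) _.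
  have -> : size (\prod_(l < r) ('X + (ga + l.+1%:R)%:P)) = r.+1.
    rewrite size_prod; last by move=> l _; rewrite -size_poly_gt0 sXC.
    under eq_bigr do rewrite sXC.
    by rewrite sum_nat_const muln2 -addnn subSn ?leq_addr// card_ord addnK.
  have : (size ((u 0)%:P * ('X + ga%:P) + (v 0)%:P)%R <= 2)%N.
    by rewrite mulrDr -addrA -polyCM -polyCD; exact: size_linear_poly.
  lia.
apply: leq_trans (size_polyMleq _ _) _.
have := IH p (al + 1) (be + 1) (ga + 1) (u \o S) (v \o S).
rewrite -ltnS => /(_ pr rp).
have -> : size (('X + al%:P) * ('X + be%:P)) = 3.
  by rewrite size_mul -?size_poly_gt0 !sXC.
move=> h; have := h (fun i pi => u0 i.+1 pi) (fun i ri => v0 i.+1 ri).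
lia.
Qed.

(** The product (X + al)(X + be) divides the first summand of the recursion; it is
coprime to the factors X + ga + l and has degree two, so the linear factor with
coefficients u 0 and v 0 must vanish. *)
Lemma moment_polynomial_eq0 r al be ga u v : 0 < ga - al -> 0 < ga - be ->
  moment_polynomial r al be ga u v = 0 ->
  (forall i, (i <= r)%N -> u i = 0) /\ (forall i, (i < r)%N -> v i = 0).
Proof.
elim: r al be ga u v => [|r IH] al be ga u v ga_al ga_be /=.
  by move=> /eqP; rewrite polyC_eq0 => /eqP u0; split=> // -[].
set L := _ + (v 0)%:P; set Pi := \prod_(l < r) _.
set A := 'X + al%:P; set B := 'X + be%:P; set K := moment_polynomial _ _ _ _ _ _.
move=> E.
have XE (z : R) : 'X + z%:P = 'X - (- z)%:P by rewrite polyCN opprK.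
have cop z : 0 < ga - z -> coprimep ('X + z%:P) Pi.
  move=> h; apply: (big_ind (coprimep _)) => [|P Q|l _]; first exact: coprimep1.
    by rewrite coprimepMr => -> ->.
  rewrite !XE coprimep_XsubC root_XsubC eqr_opp gt_eqF//.
  have l0 : 0 <= l.+1%:R :> R by []. lra.
have dL : A * B %| L.
  rewrite -(Gauss_dvdpl _ (q := Pi)); last by rewrite coprimepMl !cop.
  by move/eqP: E; rewrite addr_eq0 => /eqP ->; rewrite dvdpNr dvdp_mulr.
have sXC (z : R) : size ('X + z%:P) = 2.
  by rewrite -[z]opprK polyCN size_XsubC.
have AB0 : A * B != 0.
  by rewrite mulf_neq0// -size_poly_gt0 sXC.
have L0 : L = 0.
  apply/eqP; apply: contraT => LN0.
  have sL : (size L <= 2)%N.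
    by rewrite /L mulrDr -addrA -polyCM -polyCD; exact: size_linear_poly.
  have := leq_trans (dvdp_leq LN0 dL) sL.
  by rewrite size_mul -?size_poly_gt0 ?sXC.
move: E; rewrite L0 mul0r add0r => /eqP.
rewrite mulf_eq0 (negbTE AB0)/= => /eqP K0.
have [||u0 v0] := IH (al + 1) (be + 1) (ga + 1) _ _ _ _ K0.
- by lra.
- by lra.
have u00 : u 0 = 0.
  have := congr1 (fun q : {poly R} => q`_1) L0.
  rewrite /L mulrDr -polyCM -addrA -polyCD coefD coefMX !coefC/=.
  by rewrite addr0.
have v00 : v 0 = 0.
  have := congr1 (fun q : {poly R} => q`_0) L0.
  by rewrite /L u00 mul0r add0r !coefC/=.
by split=> -[|i] //= ir; [exact: u0|exact: v0].
Qed.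

End moment_polynomial.

(** The k-th moment of V_c.  It is locked because unification otherwise unfolds
Gamma down to its integral. *)
HB.lock Definition weight_moment {R : realType} (a b c : R) (k : nat) : R :=
  Gamma (a + k%:R + 1) * Gamma (b + k%:R + 1) / Gamma (c + (b + k%:R) + 1).

Section weight_moment.
Context {R : realType}.
Implicit Types (a b c : R) (u v : nat -> R).

Lemma weight_moment_gt0 a b c k : -1 < a -> -1 < b -> 0 < c ->
  0 < weight_moment a b c k.
Proof.
have k0 : 0 <= k%:R :> R by []. move=> a1 b1 c0.
by rewrite weight_moment.unlock divr_gt0 ?mulr_gt0 ?Gamma_gt0//; lra.
Qed.

Lemma weight_momentS a b c k : -1 < a -> -1 < b -> 0 < c ->
  (c + b + k%:R + 1) * weight_moment a b c k.+1 =
  (a + k%:R + 1) * (b + k%:R + 1) * weight_moment a b c k.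
Proof.
have k0 : 0 <= k%:R :> R by []. move=> a1 b1 c0.
have pa : 0 < a + k%:R + 1 by lra.
have pb : 0 < b + k%:R + 1 by lra.
have pc : 0 < c + b + k%:R + 1 by lra.
rewrite weight_moment.unlock -natr1 !addrA.
rewrite (Gamma_add1 _ pa) (Gamma_add1 _ pb) (Gamma_add1 _ pc).
move: (Gamma_gt0 _ pc).
move: (Gamma (a + _ + 1)) (Gamma (b + _ + 1)) (Gamma _) => Ga Gb Gc h1.
by field; rewrite (gt_eqF h1) (gt_eqF pc).
Qed.

Lemma weight_moment_add1 a b c k : -1 < b -> 0 < c ->
  weight_moment a b c k = (c + b + k%:R + 1) * weight_moment a b (c + 1) k.
Proof.
have k0 : 0 <= k%:R :> R by []. move=> b1 c0.
have pc : 0 < c + b + k%:R + 1 by lra.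
rewrite weight_moment.unlock.
have -> : c + 1 + (b + k%:R) + 1 = c + b + k%:R + 1 + 1 by ring.
rewrite addrA (Gamma_add1 _ pc).
move: (Gamma_gt0 _ pc).
move: (Gamma (a + _ + 1)) (Gamma (b + _ + 1)) (Gamma _) => Ga Gb Gc h1.
by field; rewrite (gt_eqF h1) (gt_eqF pc).
Qed.

Lemma weight_moment_shift a b c k :
  weight_moment (a + 1) (b + 1) c k = weight_moment a b c k.+1.
Proof.
rewrite weight_moment.unlock -natr1.
have -> : a + 1 + k%:R + 1 = a + (k%:R + 1) + 1 by ring.
have -> : b + 1 + k%:R + 1 = b + (k%:R + 1) + 1 by ring.
by have -> : c + (b + 1 + k%:R) + 1 = c + (b + (k%:R + 1)) + 1 by ring.
Qed.

(** Raising c by one divides the moment by a linear factor in k; this is what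
brings all moments to the common denominator of V_(c+n). *)
Lemma weight_moment_addn a b c k n : -1 < b -> 0 < c ->
  weight_moment a b c k =
  (\prod_(l < n) (c + b + 1 + l%:R + k%:R)) * weight_moment a b (c + n%:R) k.
Proof.
move=> b1 c0; elim: n => [|n IH]; first by rewrite big_ord0 mul1r addr0.
rewrite IH big_ord_recr/= -mulrA; congr (_ * _).
have cn : 0 < c + n%:R by rewrite ltr_wpDr.
rewrite (weight_moment_add1 _ _ _ k b1 cn).
have -> : c + n.+1%:R = c + n%:R + 1 by rewrite -natr1; ring.
by congr (_ * _); ring.
Qed.

Lemma moment_polynomialE r a b c u v k : -1 < a -> -1 < b -> 0 < c ->
  \sum_(i < r.+1) u i * weight_moment a b c (k + i)%N +
  \sum_(i < r) v i * weight_moment a b (c + 1) (k + i)%N =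
  (moment_polynomial r (a + 1) (b + 1) (c + b + 1) u v).[k%:R] *
    weight_moment a b (c + r%:R) k.
Proof.
elim: r a b u v => [|r IH] a b u v a1 b1 c0.
  by rewrite big_ord1 big_ord0 !addr0 addn0 hornerC.
have r0 : 0 <= r%:R :> R by [].
have k0 : 0 <= k%:R :> R by [].
have a2 : -1 < a + 1 by lra.
have b2 : -1 < b + 1 by lra.
have c1 : 0 < c + 1 by lra.
have cr : 0 < c + r%:R by lra.
have nz : c + r%:R + b + k%:R + 1 != 0 by rewrite gt_eqF//; lra.
rewrite big_ord_recl [X in _ + X]big_ord_recl !addn0 addrACA.
have -> : \sum_(i < r.+1) u (lift ord0 i) * weight_moment a b c (k + lift ord0 i)%N +
    \sum_(i < r) v (lift ord0 i) * weight_moment a b (c + 1) (k + lift ord0 i)%N =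
    (moment_polynomial r (a + 1 + 1) (b + 1 + 1) (c + b + 1 + 1) (u \o S) (v \o S)).[k%:R]
    * weight_moment a b (c + r%:R) k.+1.
  rewrite -weight_moment_shift (_ : c + b + 1 + 1 = c + (b + 1) + 1); last by ring.
  rewrite -(IH _ _ _ _ a2 b2 c0).
  congr (_ + _); apply: eq_bigr => i _;
    by rewrite weight_moment_shift lift0 addnS.
have h : weight_moment a b (c + r%:R) k.+1 =
    (a + k%:R + 1) * (b + k%:R + 1) * weight_moment a b (c + r%:R + 1) k.
  apply: (mulfI nz); rewrite (weight_momentS _ _ _ k a1 b1 cr).
  by rewrite (weight_moment_add1 a _ _ k b1 cr); ring.
rewrite h (weight_moment_add1 a b c k b1 c0) (weight_moment_addn a b (c + 1) k r b1 c1).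
have -> : c + 1 + r%:R = c + r%:R + 1 by ring.
have -> : c + r.+1%:R = c + r%:R + 1 by rewrite -natr1; ring.
rewrite [moment_polynomial r.+1 _ _ _ _ _]/= !hornerE horner_prod /=.
have -> : \prod_(i < r) ('X + (c + b + 1 + i.+1%:R)%:P).[k%:R] =
    \prod_(l < r) (c + 1 + b + 1 + l%:R + k%:R).
  apply: eq_bigr => i _; rewrite !hornerE -natr1 /=; ring.
by ring.
Qed.

End weight_moment.

(** * Combinations of two neighbouring weights *)

Section pairs.
Context {R : realType}.
Implicit Types (a b c x : R) (P Q : {poly R}) (g : nat -> R).
Local Notation mu := (@lebesgue_measure R).
Local Notation D := (`]0%R, +oo[%classic : set R).
Local Notation V := unnormalized_weight.

(** The k-th moment of the product of P with a function whose moments are g. *)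
Definition poly_moment g P (k : nat) : R := \sum_(i < size P) P`_i * g (k + i)%N.

Lemma poly_momentE N g P k : (size P <= N)%N ->
  poly_moment g P k = \sum_(i < N) P`_i * g (k + i)%N.
Proof.
move=> sP; rewrite /poly_moment (big_ord_widen N (fun i => P`_i * g (k + i)%N) sP).
rewrite big_mkcond; apply: eq_bigr => i _; case: ltnP => // h.
by rewrite nth_default// mul0r.
Qed.

Lemma poly_momentD g P Q k : poly_moment g (P + Q) k = poly_moment g P k + poly_moment g Q k.
Proof.
pose N := maxn (size P) (size Q).
have [h1 h2] : (size P <= N)%N /\ (size Q <= N)%N by rewrite /N; lia.
rewrite !(poly_momentE N)//; last by rewrite (leq_trans (size_polyD _ _)).
by rewrite -big_split; apply: eq_bigr => i _; rewrite coefD mulrDl.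
Qed.

Lemma poly_momentZ g P z k : poly_moment g (z *: P) k = z * poly_moment g P k.
Proof.
rewrite !(poly_momentE (size P)) ?size_scale_leq// mulr_sumr.
by apply: eq_bigr => i _; rewrite coefZ mulrA.
Qed.

Lemma poly_momentN g P k : poly_moment g (- P) k = - poly_moment g P k.
Proof. by rewrite -scaleN1r poly_momentZ mulN1r. Qed.

Lemma poly_momentMX g P k : poly_moment g (P * 'X) k = poly_moment g P k.+1.
Proof.
rewrite (poly_momentE (size P).+1); last first.
  by apply: leq_trans (size_polyMleq _ _) _; rewrite size_polyX addn2.
rewrite big_ord_recl coefMX eqxx mul0r add0r /poly_moment; apply: eq_bigr => i _.
by rewrite coefMX lift0/= addSnnS.
Qed.

Lemma poly_moment_derivX g P k :
  poly_moment g (P^`() * 'X) k = \sum_(i < size P) i%:R * P`_i * g (k + i)%N.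
Proof.
rewrite poly_momentMX (poly_momentE (size P)) ?size_deriv_leq//.
  case E : (size P) => [|N]; first by rewrite !big_ord0.
  rewrite [RHS]big_ord_recl mulr0n !mul0r add0r big_ord_recr [LHS]/=.
  rewrite [P^`()`_N]coef_deriv [P`_N.+1]nth_default ?E// mul0rn mul0r addr0.
  apply: eq_bigr => i _; rewrite coef_deriv lift0 addSnnS; congr (_ * _).
  by rewrite mulr_natl.
case: (eqVneq P 0) => [->|P0]; first by rewrite deriv0.
exact/ltnW/lt_size_deriv.
Qed.

Definition pair_moment a b c P Q k : R :=
  poly_moment (weight_moment a b c) P k + poly_moment (weight_moment a b (c + 1)) Q k.

Lemma pair_momentB a b c P Q P' Q' k :
  pair_moment a b c (P - P') (Q - Q') k =
  pair_moment a b c P Q k - pair_moment a b c P' Q' k.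
Proof. by rewrite /pair_moment !poly_momentD !poly_momentN; ring. Qed.

Lemma pair_momentZ a b c P Q z k :
  pair_moment a b c (z *: P) (z *: Q) k = z * pair_moment a b c P Q k.
Proof. by rewrite /pair_moment !poly_momentZ mulrDr. Qed.

Lemma pair_moment_shift a b c P Q k :
  pair_moment (a + 1) (b + 1) c P Q k = pair_moment a b c P Q k.+1.
Proof.
congr (_ + _); apply: eq_bigr => i _; by rewrite weight_moment_shift addSn.
Qed.

(** A combination with n = p + r coefficients and n vanishing moments is zero: its
moment polynomial has n roots and size at most n. *)
Lemma pair_moment_eq0 p r a b c P Q : -1 < a -> -1 < b -> 0 < c -> 0 < c + b - a ->
  (p <= r.+1)%N -> (r <= p.+1)%N -> (size P <= p)%N -> (size Q <= r)%N ->
  (forall k, (k < p + r)%N -> pair_moment a b c P Q k = 0) -> P = 0 /\ Q = 0.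
Proof.
move=> a1 b1 c0 cba pr rp sP sQ H.
pose K := moment_polynomial r (a + 1) (b + 1) (c + b + 1) (nth 0 P) (nth 0 Q).
have K0 : K = 0.
  apply/eqP; apply: contraT => KN0.
  have sK : (size K <= p + r)%N.
    apply: size_moment_polynomial => // i hi; rewrite nth_default//.
      exact: leq_trans hi.
    exact: leq_trans hi.
  pose rs : seq R := [seq k%:R | k <- iota 0 (p + r)].
  have : (size rs < size K)%N.
    apply: max_poly_roots => //.
      apply/allP => y /mapP [k]; rewrite mem_iota => /andP[_ kn] ->.
      have k0 : 0 <= k%:R :> R by [].
      have m0 : weight_moment a b (c + r%:R) k != 0.
        have r0 : 0 <= r%:R :> R by [].
        by rewrite gt_eqF// weight_moment_gt0//; lra.
      apply/eqP; apply: (mulIf m0); rewrite mul0r -moment_polynomialE//.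
      rewrite -[RHS](H k)//; congr (_ + _); last by rewrite [RHS](poly_momentE r).
      by rewrite [RHS](poly_momentE r.+1)// (leq_trans sP).
    by rewrite map_inj_uniq ?iota_uniq// => i j /eqP; rewrite eqr_nat => /eqP.
  by rewrite size_map size_iota ltnNge sK.
have [||P0 Q0] := moment_polynomial_eq0 _ _ _ _ _ _ _ _ K0; [by lra|by lra|].
split; apply/polyP => i; rewrite coef0.
  case: (leqP i r) => ir; first exact: P0.
  by rewrite nth_default// (leq_trans sP)// (leq_trans pr).
by case: (ltnP i r) => ir; [exact: Q0|rewrite nth_default// (leq_trans sQ)].
Qed.

(** [derive_fst] and [derive_snd] are the coefficients of V_c and V_(c+1) in the
derivative of x (P V_c + Q V_(c+1)). *)
Definition derive_fst a b c P Q : {poly R} :=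
  P^`() * 'X + (a + 1 - c) *: P - P * 'X - Q.
Definition derive_snd a b c P Q : {poly R} :=
  (c * (c + b - a)) *: P + Q^`() * 'X + (c + b + 1) *: Q.

Lemma is_derive_pair a b c P Q x : 0 < c -> 0 < x ->
  is_derive x 1 (fun y => P.[y] * V (a + 1) (b + 1) c y + Q.[y] * V (a + 1) (b + 1) (c + 1) y)
    ((derive_fst a b c P Q).[x] * V a b c x + (derive_snd a b c P Q).[x] * V a b (c + 1) x).
Proof.
move=> c0 x0.
have HP := is_deriveM (is_derive_poly P x) (is_derive_unnormalized_weight a b c x c0 x0).
have HQ := is_deriveM (is_derive_poly Q x) (is_derive_unnormalized_weightS a b c x c0 x0).
apply: (is_derive_eq (is_deriveD HP HQ)).
rewrite !(unnormalized_weight_shift _ _ _ _ x0) /derive_fst /derive_snd.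
move: (V a b c x) (V a b (c + 1) x) => v v'.
by rewrite !hornerE /GRing.scale/=; ring.
Qed.

Lemma size_derivX P : (size (P^`() * 'X)%R <= size P)%N.
Proof.
case: (eqVneq P 0) => [->|P0]; first by rewrite deriv0 mul0r.
apply: leq_trans (size_polyMleq _ _) _; rewrite size_polyX addn2/=.
exact: lt_size_deriv.
Qed.

Lemma size_polyMX_leq P : (size (P * 'X)%R <= (size P).+1)%N.
Proof. by apply: leq_trans (size_polyMleq _ _) _; rewrite size_polyX addn2. Qed.

Lemma size_derive_fst p r a b c P Q : (size P <= p)%N -> (size Q <= r)%N ->
  (size (derive_fst a b c P Q) <= maxn p.+1 r)%N.
Proof.
move=> sP sQ; apply: leq_trans (size_polyD _ _) _; rewrite size_polyN geq_max.
rewrite [X in _ && X]leq_max sQ orbT andbT.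
apply: leq_trans (size_polyD _ _) _; rewrite size_polyN geq_max.
apply/andP; split; last first.
  by rewrite leq_max (leq_trans (size_polyMX_leq _)).
rewrite leq_max ltnW//; apply: leq_ltn_trans (size_polyD _ _) _.
rewrite gtn_max !ltnS (leq_trans (size_derivX _))//=.
exact: leq_trans (size_scale_leq _ _) sP.
Qed.

Lemma size_derive_snd p r a b c P Q : (size P <= p)%N -> (size Q <= r)%N ->
  (size (derive_snd a b c P Q) <= maxn p r)%N.
Proof.
move=> sP sQ; apply: leq_trans (size_polyD _ _) _; rewrite geq_max.
apply/andP; split; last first.
  by rewrite leq_max (leq_trans (size_scale_leq _ _) sQ) orbT.
apply: leq_trans (size_polyD _ _) _; rewrite geq_max; apply/andP; split.
  by rewrite leq_max (leq_trans (size_scale_leq _ _) sP).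
by rewrite leq_max (leq_trans (size_derivX _) sQ) orbT.
Qed.

(** The counterpart on moments of the formula for the derivative of x V_c. *)
Lemma weight_moment_contiguous a b c k : -1 < a -> -1 < b -> 0 < c ->
  weight_moment a b c k.+1 = (k%:R + a + 1 - c) * weight_moment a b c k +
    c * (c + b - a) * weight_moment a b (c + 1) k.
Proof.
have k0 : 0 <= k%:R :> R by []. move=> a1 b1 c0.
have nz : c + b + k%:R + 1 != 0 by rewrite gt_eqF//; lra.
apply: (mulfI nz); rewrite (weight_momentS _ _ _ k a1 b1 c0).
by rewrite (weight_moment_add1 a _ _ k b1 c0); ring.
Qed.

(** Integration by parts against x^k, obtained from the explicit moments of the
monomials in place of estimates of the weights at 0 and at infinity. *)
Lemma pair_moment_derive a b c P Q k : -1 < a -> -1 < b -> 0 < c ->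
  pair_moment a b c (derive_fst a b c P Q) (derive_snd a b c P Q) k =
  - k%:R * pair_moment a b c P Q k.
Proof.
move=> a1 b1 c0; rewrite /pair_moment /derive_fst /derive_snd.
rewrite !poly_momentD !poly_momentN !poly_momentZ !poly_moment_derivX poly_momentMX.
set m := weight_moment a b c; set m' := weight_moment a b (c + 1).
have HP : \sum_(i < size P) i%:R * P`_i * m (k + i)%N =
    poly_moment m P k.+1 - (k%:R + a + 1 - c) * poly_moment m P k
    - c * (c + b - a) * poly_moment m' P k.
  rewrite /poly_moment !mulr_sumr -!sumrB; apply: eq_bigr => i _.
  by rewrite addSn /m weight_moment_contiguous// natrD /m'; ring.
have HQ : \sum_(i < size Q) i%:R * Q`_i * m' (k + i)%N =
    poly_moment m Q k - (k%:R + c + b + 1) * poly_moment m' Q k.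
  rewrite /poly_moment !mulr_sumr -!sumrB; apply: eq_bigr => i _.
  by rewrite /m (weight_moment_add1 _ _ _ _ b1 c0) natrD /m'; ring.
by rewrite HP HQ; ring.
Qed.

(** [lower_fst] and [lower_snd] rewrite a combination of V_(c+1) and V_(c+2) as one
of V_c and V_(c+1), by the contiguous relation. *)
Definition lower_fst a b c Q : {poly R} := - ((c + 1) * (c + 1 + b - a))^-1 *: Q.
Definition lower_snd a b c P Q : {poly R} :=
  P + ((c + 1) * (c + 1 + b - a))^-1 *: (Q * 'X + (b - a + 2 * c + 1) *: Q).

Lemma lower_pairE a b c P Q x : 0 < c -> 0 < c + b - a -> 0 < x ->
  P.[x] * V a b (c + 1) x + Q.[x] * V a b (c + 1 + 1) x =
  (lower_fst a b c Q).[x] * V a b c x + (lower_snd a b c P Q).[x] * V a b (c + 1) x.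
Proof.
move=> c0 cba x0; rewrite /lower_fst /lower_snd.
have := unnormalized_weight_contiguous a b _ _ c0 x0.
move: (V a b (c + 1 + 1) x) (V a b (c + 1) x) (V a b c x) => V2 V1 V0.
have c1 : c + 1 != 0 by rewrite gt_eqF//; lra.
have c2 : c + 1 + b - a != 0 by rewrite gt_eqF//; lra.
have c12 : (c + 1) * (c + 1 + b - a) != 0 by rewrite mulf_neq0.
move=> /(canRL (mulKf c12)) ->.
by rewrite !hornerE /=; field; rewrite c1 c2.
Qed.

Lemma pair_moment_lower a b c P Q k : -1 < a -> -1 < b -> 0 < c -> 0 < c + b - a ->
  pair_moment a b (c + 1) P Q k =
  pair_moment a b c (lower_fst a b c Q) (lower_snd a b c P Q) k.
Proof.
move=> a1 b1 c0 cba; rewrite /pair_moment /lower_fst /lower_snd.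
have c1 : 0 < c + 1 by lra.
have c2 : 0 < c + 1 + b - a by lra.
rewrite scaleNr !(poly_momentD, poly_momentN, poly_momentZ, poly_momentMX).
set m := weight_moment a b c; set m' := weight_moment a b (c + 1).
set m'' := weight_moment a b (c + 1 + 1).
have HQ : (c + 1) * (c + 1 + b - a) * poly_moment m'' Q k =
    poly_moment m' Q k.+1 + (b - a + 2 * c + 1) * poly_moment m' Q k - poly_moment m Q k.
  rewrite /poly_moment !mulr_sumr -big_split -sumrB; apply: eq_bigr => i _ /=.
  rewrite addSn /m (weight_moment_add1 _ _ _ _ b1 c0).
  by rewrite /m' weight_moment_contiguous// /m''; ring.
have nz : (c + 1) * (c + 1 + b - a) != 0 by rewrite gt_eqF// mulr_gt0.
apply: (mulfI nz); rewrite mulrDr HQ.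
by field; rewrite !gt_eqF.
Qed.

Lemma size_lower_fst a b c Q : (size (lower_fst a b c Q) <= size Q)%N.
Proof. exact: size_scale_leq. Qed.

Lemma size_lower_snd a b c P Q :
  (size (lower_snd a b c P Q) <= maxn (size P) (size Q).+1)%N.
Proof.
apply: leq_trans (size_polyD _ _) _; rewrite geq_max leq_maxl/=.
apply: leq_trans (size_scale_leq _ _) _; apply: leq_trans (size_polyD _ _) _.
rewrite geq_max !leq_max size_polyMX_leq orbT/=.
by rewrite [X in _ || X]ltnW ?orbT// ltnS size_scale_leq.
Qed.

(** Each derivative takes parameters a+1, b+1 to a, b and adds one coefficient.  If
r <= p the new coefficient belongs to P.  If r = p + 1, differentiate at c + 1,
with p coefficients on both sides, and then lower c: both polynomials come out
with the right size.  The factor z carries the normalising constant of the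
weight through the derivatives. *)
Lemma rodrigues_pair n p r a b c z : -1 < a -> -1 < b -> 0 < c -> 0 < c + b - a ->
  (p <= r.+1)%N -> (r <= p.+1)%N -> (p + r = n.+1)%N ->
  exists P Q : {poly R},
  [/\ (size P <= p)%N, (size Q <= r)%N,
    (forall x, 0 < x -> derive1n n (fun y => z * V (a + n%:R) (b + n%:R) (c + r%:R) y) x =
       z * (P.[x] * V a b c x + Q.[x] * V a b (c + 1) x)),
    (forall k, (k < n)%N -> pair_moment a b c P Q k = 0) &
    pair_moment a b c P Q n = (-1) ^+ n * n`!%:R * weight_moment a b (c + r%:R) n].
Proof.
elim: n p r a b c => [|n IH] p r a b c a1 b1 c0 cba pr rp prn.
  have [[-> ->]|[-> ->]] : (p = 1 /\ r = 0)%N \/ (p = 0 /\ r = 1)%N by lia.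
    exists 1, 0; rewrite size_poly1 size_poly0; split => //.
      by move=> x _; rewrite derive1n0 hornerC horner0 mul1r mul0r !addr0.
    rewrite /pair_moment /poly_moment size_poly0 size_poly1 big_ord0 big_ord1.
    by rewrite addr0 addn0 coefC expr0 fact0 !mul1r addr0.
  exists 0, 1; rewrite size_poly1 size_poly0; split => //.
    by move=> x _; rewrite derive1n0 horner0 hornerC mul1r mul0r !addr0 add0r.
  rewrite /pair_moment /poly_moment size_poly0 size_poly1 big_ord0 big_ord1.
  by rewrite add0r addn0 coefC expr0 fact0 !mul1r.
have a2 : -1 < a + 1 by lra.
have b2 : -1 < b + 1 by lra.
(* One derivative, at a parameter c' that is c or c + 1. *)
have step c' r' p' : 0 < c' -> 0 < c' + b - a -> c' + r'%:R = c + r%:R ->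
    (p' <= r'.+1)%N -> (r' <= p'.+1)%N -> (p' + r' = n.+1)%N ->
  exists P Q : {poly R},
  [/\ (size P <= maxn p'.+1 r')%N, (size Q <= maxn p' r')%N,
    (forall x, 0 < x ->
       derive1n n.+1 (fun y => z * V (a + n.+1%:R) (b + n.+1%:R) (c + r%:R) y) x =
       z * (P.[x] * V a b c' x + Q.[x] * V a b (c' + 1) x)),
    (forall k, (k < n.+1)%N -> pair_moment a b c' P Q k = 0) &
    pair_moment a b c' P Q n.+1 =
      (-1) ^+ n.+1 * (n.+1)`!%:R * weight_moment a b (c + r%:R) n.+1].
  move=> c'0 cba' cr pr' rp' prn'.
  have cba2 : 0 < c' + (b + 1) - (a + 1) by lra.
  have [P [Q [sP sQ dPQ mPQ mn]]] := IH p' r' _ _ _ a2 b2 c'0 cba2 pr' rp' prn'.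
  exists (derive_fst a b c' P Q), (derive_snd a b c' P Q); split.
  - exact: size_derive_fst.
  - exact: size_derive_snd.
  - move=> x x0; rewrite derive1nS derive1E.
    have h := is_deriveZ z (is_derive_pair a b c' P Q _ c'0 x0).
    have E : \forall y \near x, (z \*: (fun y => P.[y] * V (a + 1) (b + 1) c' y +
          Q.[y] * V (a + 1) (b + 1) (c' + 1) y)) y =
        derive1n n (fun y => z * V (a + n.+1%:R) (b + n.+1%:R) (c + r%:R) y) y.
      near=> y; have y0 : 0 < y by near: y; exact: lt_nbhsr.
      rewrite -cr (_ : a + n.+1%:R = a + 1 + n%:R); last by rewrite -natr1; ring.
      rewrite (_ : b + n.+1%:R = b + 1 + n%:R); last by rewrite -natr1; ring.
      by rewrite dPQ.
    have h' := near_eq_is_derive E h.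
    by rewrite (@derive_val _ _ _ _ _ _ _ h').
  - move=> k kn; rewrite pair_moment_derive//; case: k kn => [|k] kn.
      by rewrite oppr0 mul0r.
    by rewrite -pair_moment_shift mPQ ?mulr0.
  - rewrite pair_moment_derive// -pair_moment_shift mn weight_moment_shift -cr.
    by rewrite exprS factS natrM; ring.
have [rp'|pr'] := leqP r p.
  case: p pr rp prn rp' => [|p] pr rp prn rp'; first by lia.
  have [|||P [Q [sP sQ dPQ mPQ mn]]] := step c r p c0 cba erefl; [by lia|by lia|by lia|].
  by exists P, Q; split => //; lia.
have rE : r = p.+1 by lia.
have c1 : 0 < c + 1 by lra.
have cba1 : 0 < c + 1 + b - a by lra.
have crE : c + 1 + p%:R = c + r%:R by rewrite rE -natr1; ring.
have [|||P [Q [sP sQ dPQ mPQ mn]]] := step (c + 1) p p c1 cba1 crE; [by lia|by lia|by lia|].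
exists (lower_fst a b c Q), (lower_snd a b c P Q); split.
- by have := size_lower_fst a b c Q; lia.
- by have := size_lower_snd a b c P Q; lia.
- by move=> x x0; rewrite (dPQ _ x0) (lower_pairE _ _ _ _ _ _ c0 cba x0).
- by move=> k kn; rewrite -pair_moment_lower// mPQ.
- by rewrite -pair_moment_lower.
Unshelve. all: by end_near.
Qed.

End pairs.

(** * Type I functions *)

Section integrals.
Context {R : realType}.
Implicit Types (a b c x : R) (P Q : {poly R}).
Local Notation mu := (@lebesgue_measure R).
Local Notation D := (`]0%R, +oo[%classic : set R).
Local Notation V := unnormalized_weight.

Lemma unnormalized_weight_ge0 a b c x : 0 < c -> 0 <= V a b c x.
Proof.
move=> c0; rewrite unnormalized_weightE !mulr_ge0 ?powR_ge0 ?expR_ge0//.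
  by rewrite invr_ge0 ltW// Gamma_gt0.
by apply: Rintegral_ge0 => t _; exact: tricomi_kernel_ge0.
Qed.

Lemma measurable_unnormalized_weight a b c : 0 < c -> measurable_fun D (V a b c).
Proof.
move=> c0; apply: open_continuous_measurable_fun; first exact: interval_open.
move=> x; rewrite inE => /half_line_gt0 x0.
apply/differentiable_continuous/derivable1_diffP.
have h := is_derive_unnormalized_weight (a - 1) (b - 1) _ _ c0 x0.
by rewrite !subrK in h; exact: ex_derive.
Qed.

Lemma integral_monomial_weight a b c k : -1 < a -> -1 < b -> 0 < c ->
  (\int[mu]_(x in D) (x ^+ k * V a b c x)%:E = (weight_moment a b c k)%:E)%E.
Proof.
move=> a1 b1 c0; have k0 : 0 <= k%:R :> R by [].
have ak : -1 < a + k%:R by lra.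
have bk : -1 < b + k%:R by lra.
rewrite weight_moment.unlock -(integral_unnormalized_weight _ _ _ ak bk c0).
by apply: eq_integral_half_line => x x0; rewrite unnormalized_weight_shiftn.
Qed.

Lemma integrable_monomial_weight a b c k : -1 < a -> -1 < b -> 0 < c ->
  mu.-integrable D (fun x => (x ^+ k * V a b c x)%:E).
Proof.
move=> a1 b1 c0; apply/integrableP; split.
  apply/measurable_EFinP; apply: measurable_funM; last exact: measurable_unnormalized_weight.
  exact: measurable_funX.
rewrite (eq_integral_half_line (fun x => (x ^+ k * V a b c x)%:E)).
  by rewrite integral_monomial_weight// ltry.
move=> x x0; rewrite /= ger0_norm// mulr_ge0 ?unnormalized_weight_ge0//.
by rewrite exprn_ge0// ltW.
Qed.

Lemma poly_weightE P a b c k x :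
  (x ^+ k * (P.[x] * V a b c x))%:E =
  (\sum_(i < size P) (P`_i)%:E * (x ^+ (k + i)%N * V a b c x)%:E)%E.
Proof.
rewrite horner_coef mulr_suml mulr_sumr -sumEFin.
by apply: eq_bigr => i _; rewrite -EFinM exprD; congr EFin; ring.
Qed.

Lemma integrable_poly_weight P a b c k : -1 < a -> -1 < b -> 0 < c ->
  mu.-integrable D (fun x => (x ^+ k * (P.[x] * V a b c x))%:E).
Proof.
move=> a1 b1 c0.
have mD : measurable (D : set (measurableTypeR R)) by exact: measurable_itv.
have -> := funext (poly_weightE P a b c k).
apply: integrable_sum => // i _; apply: integrableZl => //.
exact: integrable_monomial_weight.
Qed.

Lemma integral_poly_weight P a b c k : -1 < a -> -1 < b -> 0 < c ->
  (\int[mu]_(x in D) (x ^+ k * (P.[x] * V a b c x))%:E =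
   (poly_moment (weight_moment a b c) P k)%:E)%E.
Proof.
move=> a1 b1 c0.
have mD : measurable (D : set (measurableTypeR R)) by exact: measurable_itv.
rewrite (eq_integral_half_line (fun x =>
  (\sum_(i < size P) (P`_i)%:E * (x ^+ (k + i)%N * V a b c x)%:E)%E)); last first.
  by move=> x _; rewrite poly_weightE.
rewrite integral_sum//; last first.
  by move=> i; apply: integrableZl => //; exact: integrable_monomial_weight.
rewrite /poly_moment -sumEFin; apply: eq_bigr => i _.
rewrite integralZl//; last exact: integrable_monomial_weight.
by rewrite EFinM; congr (_ * _)%E; exact: integral_monomial_weight.
Qed.

Lemma integral_pair P Q a b c k : -1 < a -> -1 < b -> 0 < c ->
  (\int[mu]_(x in D) (x ^+ k * (P.[x] * V a b c x + Q.[x] * V a b (c + 1) x))%:E =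
   (pair_moment a b c P Q k)%:E)%E.
Proof.
move=> a1 b1 c0; have c1 : 0 < c + 1 by lra.
have mD : measurable (D : set (measurableTypeR R)) by exact: measurable_itv.
rewrite (eq_integral_half_line (fun x => (x ^+ k * (P.[x] * V a b c x))%:E +
  (x ^+ k * (Q.[x] * V a b (c + 1) x))%:E)%E); last first.
  by move=> x _; rewrite -EFinD mulrDr.
rewrite integralD//; try exact: integrable_poly_weight.
by rewrite /pair_moment EFinD; congr (_ + _)%E; exact: integral_poly_weight.
Qed.

(** The type I condition in terms of V_c, V_(c+1) and explicit moments, independent
of which weight is listed first. *)
Definition is_type_I_pair n p r a b c (F : R -> R) : Prop :=
  exists P Q : {poly R},
  [/\ (size P <= p)%N, (size Q <= r)%N,
    (forall x, 0 < x -> F x = P.[x] * V a b c x + Q.[x] * V a b (c + 1) x),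
    (forall k, (k.+1 < n)%N -> pair_moment a b c P Q k = 0) &
    pair_moment a b c P Q n.-1 = 1].

Definition weight_constant a b c : R :=
  Gamma (c + b + 1) / (Gamma (a + 1) * Gamma (b + 1)).

Lemma weight_constant_gt0 a b c : -1 < a -> -1 < b -> 0 < c ->
  0 < weight_constant a b c.
Proof.
move=> a1 b1 c0.
have pa : 0 < a + 1 by lra.
have pb : 0 < b + 1 by lra.
have pc : 0 < c + b + 1 by lra.
by rewrite divr_gt0 ?mulr_gt0 ?Gamma_gt0.
Qed.

Lemma weightWE a b c x : weightW a b c x = weight_constant a b c * V a b c x.
Proof. by rewrite /weightW /weight_constant /V !mulrA. Qed.

(** The disjunction lists the two orders of the weights, that is, d = 0 and d = 1. *)
Lemma is_type_I_functionE n p r a b c (F : R -> R) (w1 w2 : R -> R) :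
  -1 < a -> -1 < b -> 0 < c ->
  (p = uphalf n /\ r = n./2 /\ w1 = weightW a b c /\ w2 = weightW a b (c + 1)) \/
  (r = uphalf n /\ p = n./2 /\ w1 = weightW a b (c + 1) /\ w2 = weightW a b c) ->
  is_type_I_function n (w1, w2) F <-> is_type_I_pair n p r a b c F.
Proof.
move=> a1 b1 c0 H; have c1 : 0 < c + 1 by lra.
have k0 := weight_constant_gt0 _ _ _ a1 b1 c0.
have k1 := weight_constant_gt0 _ _ _ a1 b1 c1.
have momE P Q k : (forall x, 0 < x -> F x = P.[x] * V a b c x + Q.[x] * V a b (c + 1) x) ->
    (\int[mu]_(x in D) (x ^+ k * F x)%:E = (pair_moment a b c P Q k)%:E)%E.
  move=> FE; rewrite -integral_pair//; apply: eq_integral_half_line => x x0.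
  by rewrite FE.
have szZ (z : R) (P : {poly R}) m : (size P <= m)%N -> (size (z *: P) <= m)%N.
  exact: leq_trans (size_scale_leq _ _).
split=> [[A [B [sA sB FE F0 F1]]]|[P [Q [sP sQ FE F0 F1]]]].
- case: H => -[pE [rE [w1E w2E]]].
  + exists (weight_constant a b c *: A), (weight_constant a b (c + 1) *: B).
    have FE' x : 0 < x -> F x = (weight_constant a b c *: A).[x] * V a b c x +
        (weight_constant a b (c + 1) *: B).[x] * V a b (c + 1) x.
      move=> x0; rewrite (FE _ x0) /= w1E w2E !weightWE !hornerZ.
      by move: (V a b c x) (V a b (c + 1) x) => v v'; ring.
    split => //; rewrite ?pE ?rE; try exact: szZ.
      by move=> k kn; apply/EFin_inj; rewrite -momE// F0.
    by apply/EFin_inj; rewrite -momE// F1.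
  + exists (weight_constant a b c *: B), (weight_constant a b (c + 1) *: A).
    have FE' x : 0 < x -> F x = (weight_constant a b c *: B).[x] * V a b c x +
        (weight_constant a b (c + 1) *: A).[x] * V a b (c + 1) x.
      move=> x0; rewrite (FE _ x0) /= w1E w2E !weightWE !hornerZ.
      by move: (V a b c x) (V a b (c + 1) x) => v v'; ring.
    split => //; rewrite ?pE ?rE; try exact: szZ.
      by move=> k kn; apply/EFin_inj; rewrite -momE// F0.
    by apply/EFin_inj; rewrite -momE// F1.
- have PE x : P.[x] * V a b c x = ((weight_constant a b c)^-1 *: P).[x] * weightW a b c x.
    rewrite weightWE hornerZ; move: (V a b c x) => v.
    by move: (weight_constant a b c) k0 => K K0; field; rewrite gt_eqF.
  have QE x : Q.[x] * V a b (c + 1) x =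
      ((weight_constant a b (c + 1))^-1 *: Q).[x] * weightW a b (c + 1) x.
    rewrite weightWE hornerZ; move: (V a b (c + 1) x) => v.
    by move: (weight_constant a b (c + 1)) k1 => K K0; field; rewrite gt_eqF.
  have M0 k : (k.+1 < n)%N -> (\int[mu]_(x in D) (x ^+ k * F x)%:E = 0)%E.
    by move=> kn; rewrite (momE P Q)// F0.
  have M1 : (\int[mu]_(x in D) (x ^+ n.-1 * F x)%:E = 1)%E.
    by rewrite (momE P Q)// F1.
  case: H => -[pE [rE [w1E w2E]]].
  + exists ((weight_constant a b c)^-1 *: P), ((weight_constant a b (c + 1))^-1 *: Q).
    split => //=; rewrite -?pE -?rE; try exact: szZ.
    by move=> x x0; rewrite w1E w2E -PE -QE (FE _ x0).
  + exists ((weight_constant a b (c + 1))^-1 *: Q), ((weight_constant a b c)^-1 *: P).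
    split => //=; rewrite -?pE -?rE; try exact: szZ.
    by move=> x x0; rewrite w1E w2E -PE -QE (FE _ x0) addrC.
Qed.

(** The normalised derivative is a type I function by [rodrigues_pair]; any other one
differs from it by a combination with n + 1 vanishing moments. *)
Lemma is_type_I_pairE n p r a b c (F : R -> R) : -1 < a -> -1 < b -> 0 < c ->
  0 < c + b - a -> (p <= r.+1)%N -> (r <= p.+1)%N -> (p + r = n.+1)%N ->
  is_type_I_pair n.+1 p r a b c F <->
  forall x, 0 < x -> F x = (-1) ^+ n / n`!%:R *
    derive1n n (weightW (a + n%:R) (b + n%:R) (c + r%:R)) x.
Proof.
move=> a1 b1 c0 cba pr rp prn.
pose K := weight_constant (a + n%:R) (b + n%:R) (c + r%:R).
have [P [Q [sP sQ dPQ m0 m1]]] := rodrigues_pair n p r a b c K a1 b1 c0 cba pr rp prn.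
have WE : weightW (a + n%:R) (b + n%:R) (c + r%:R) =
    fun y => K * V (a + n%:R) (b + n%:R) (c + r%:R) y.
  by apply/funext => y; rewrite weightWE.
pose z := (-1) ^+ n / n`!%:R * K.
have nf : n`!%:R != 0 :> R by rewrite pnatr_eq0 -lt0n fact_gt0.
have mz k : (k < n)%N -> pair_moment a b c (z *: P) (z *: Q) k = 0.
  by move=> kn; rewrite pair_momentZ m0 ?mulr0.
have mz1 : pair_moment a b c (z *: P) (z *: Q) n = 1.
  rewrite pair_momentZ m1 /z.
  have -> : (-1) ^+ n / n`!%:R * K * ((-1) ^+ n * n`!%:R * weight_moment a b (c + r%:R) n)
    = ((-1) ^+ n * (-1) ^+ n) * (K * weight_moment a b (c + r%:R) n) by field.
  rewrite -exprMn mulrNN mul1r expr1n mul1r /K /weight_constant weight_moment.unlock.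
  have n0 : 0 <= n%:R :> R by [].
  have r0 : 0 <= r%:R :> R by [].
  have pa : 0 < a + n%:R + 1 by lra.
  have pb : 0 < b + n%:R + 1 by lra.
  have pc : 0 < c + r%:R + (b + n%:R) + 1 by lra.
  move: (Gamma_gt0 _ pa) (Gamma_gt0 _ pb) (Gamma_gt0 _ pc).
  move: (Gamma _) (Gamma _) (Gamma _) => x y t x0 y0 t0.
  by field; rewrite !gt_eqF.
have zE x : 0 < x -> (-1) ^+ n / n`!%:R *
    derive1n n (weightW (a + n%:R) (b + n%:R) (c + r%:R)) x =
    (z *: P).[x] * V a b c x + (z *: Q).[x] * V a b (c + 1) x.
  move=> x0; rewrite WE (dPQ _ x0) /z !hornerZ.
  by move: (V a b c x) (V a b (c + 1) x) => v v'; ring.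
have szZ (S : {poly R}) m : (size S <= m)%N -> (size (z *: S) <= m)%N.
  exact: leq_trans (size_scale_leq _ _).
split=> [[A [B [sA sB FE F0 F1]]]|FE].
- have [AP BQ] : A - z *: P = 0 /\ B - z *: Q = 0.
    apply: (pair_moment_eq0 p r a b c) => //.
    + by rewrite (leq_trans (size_polyD _ _))// size_polyN geq_max sA szZ.
    + by rewrite (leq_trans (size_polyD _ _))// size_polyN geq_max sB szZ.
    move=> k; rewrite prn ltnS leq_eqVlt => /predU1P[->|kn]; rewrite pair_momentB.
      by rewrite F1 mz1 subrr.
    by rewrite F0// mz// subrr.
  move=> x x0; rewrite zE// FE//.
  by move/subr0_eq: AP => ->; move/subr0_eq: BQ => ->.
- exists (z *: P), (z *: Q); split; rewrite ?szZ//.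
  by move=> x x0; rewrite FE// zE.
Qed.

End integrals.

Theorem theorem2p9 (R : realType) (a b c : R) (ha : -1 < a) (hb : -1 < b)
    (hc : Num.max 0 (a - b) < c) (n d : nat) (hn : (1 <= n)%N) (hd : (d <= 1)%N)
    (Q : R -> R) :
  is_type_I_function n (weightWbar d a b c) Q <->
  forall x : R, 0 < x ->
    Q x = (-1) ^+ n.-1 / (n.-1)`!%:R *
          derive1n n.-1
            (weightW (a + n%:R - 1) (b + n%:R - 1) (c + ((n + d)./2)%:R)) x.
Proof.
move: hc; rewrite gt_max => /andP[c0 cab].
have cba : 0 < c + b - a by lra.
case: n hn => [//|n] _ /=.
have -> : a + n.+1%:R - 1 = a + n%:R by rewrite -natr1; ring.
have -> : b + n.+1%:R - 1 = b + n%:R by rewrite -natr1; ring.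
pose r := ((n.+1 + d)./2)%N; pose p := (n.+1 - r)%N.
have [dE|dE] : d = 0%N \/ d = 1%N by case: d hd {r p} => [|[|]]; [left|right|].
- rewrite -(is_type_I_pairE n p r)//; try by rewrite /p /r dE; lia.
  apply: is_type_I_functionE => //; left.
  rewrite dE addr0 subr0 /p /r dE addn0; split; last by [].
  by lia.
- rewrite -(is_type_I_pairE n p r)//; try by rewrite /p /r dE; lia.
  apply: is_type_I_functionE => //; right.
  rewrite dE addrK /p /r dE addn1; split; first by lia.
  by split; first by lia.
Qed.
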